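(* There is an absolute constant $C>0$ such that the following holds. Consider the problem $\min_{x\in\mathbb{R}^d}F(x)$ with $F(x)=f(x)+\Psi(x)=\frac1n\sum_{i=1}^n f_i(x)+\Psi(x)$, where $f$ is convex and each $f_i$ (not necessarily convex) is $L$-upper smooth and $l$-lower smooth, with $L>0$ and $l\ge0$. Let $x^*$ be a minimizer of $F$ and let $x^\phi\in\mathbb{R}^d$ satisfy $\|x^\phi-x^*\|^2\le\Theta$ and $F(x^\phi)-F(x^* )\le\Delta$ for parameters $\Theta,\Delta>0$. Let $\varepsilon>0$ and set $$\eta=\min\Big\{\frac1{13L},\ \frac{\varepsilon}{312\sqrt2\,\Theta L l}\Big\},\qquad m_0=\frac{\Theta}{\eta\Delta},\qquad S=\log_2(\Delta/\varepsilon)$$ (the second term in the minimum is read as $+\infty$ if $l=0$), and assume that $m_0$ and $S$ are positive integers. Then the output $\widetilde{x}^S$ of $\mathtt{SVRG}_{\mathtt{nc}}^{++}(x^\phi,m_0,S,\eta)$ satisfies $$\mathbb{E}\big[F(\widetilde{x}^S)-F(x^* )\big]\le C\varepsilon,$$ and its total gradient complexity is at most $C(S\cdot n+2^S\cdot m_0)$, which is $O\big(n\log\frac\Delta\varepsilon+\frac{L\Theta}{\varepsilon}+\frac{Ll\Theta^2}{\varepsilon^2}\big)$ (with an absolute implied constant).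
   Context: Setting: $n,d\ge1$; each $f_i:\mathbb{R}^d\to\mathbb{R}$ is differentiable; $\Psi:\mathbb{R}^d\to\mathbb{R}\cup\{+\infty\}$ is proper, convex and lower semicontinuous. $\|\cdot\|$ is the Euclidean norm. A differentiable function $g$ is $L$-upper smooth if $g(y)-g(x)-\langle\nabla g(x),y-x\rangle\le\frac L2\|y-x\|^2$ for all $x,y\in\mathbb{R}^d$, and $l$-lower smooth if $g(y)-g(x)-\langle\nabla g(x),y-x\rangle\ge-\frac l2\|y-x\|^2$ for all $x,y$. Algorithm $\mathtt{SVRG}_{\mathtt{nc}}^{++}(x^\phi,m_0,S,\eta)$: Let $m_s=2^s m_0$ for $s=1,\dots,S$ and $T=m_1+\cdots+m_S$. Step lengths $\eta_t^s$ ($1\le s\le S$, $0\le t\le m_s$) are defined by $\eta_t^s=\eta\sqrt T/\sqrt{2T-k}$ with $k=m_1+\cdots+m_{s-1}+t$; thus $\eta_{m_s}^s=\eta_0^{s+1}$, $\eta_0^1=\eta/\sqrt2$ and $\eta_{m_S}^S=\eta$. Set $\widetilde{x}^0=x^\phi$ and $x_0^1=x^\phi$. For epochs $s=1,\dots,S$: compute $\widetilde\mu_{s-1}=\nabla f(\widetilde{x}^{s-1})$; for $t=0,\dots,m_s-1$ pick $i=i_t^s$ uniformly at random in $\{1,\dots,n\}$ (independently of all previous choices), set $\xi_t^s=\nabla f_i(x_t^s)-\nabla f_i(\widetilde{x}^{s-1})+\widetilde\mu_{s-1}$ and $x_{t+1}^s=\arg\min_{y\in\mathbb{R}^d}\{\frac1{2\eta_{t+1}^s}\|x_t^s-y\|^2+\Psi(y)+\langle\xi_t^s,y\rangle\}$;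 after the inner loop set $\widetilde{x}^s=\frac1{m_s}\sum_{t=0}^{m_s-1}x_t^s$ and $x_0^{s+1}=x_{m_s}^s$. Return $\widetilde{x}^S$. The gradient complexity is the total number of evaluations of component gradients $\nabla f_i(\cdot)$; a full gradient $\nabla f$ counts as $n$ evaluations. The expectation is over all random indices. *)

(* Defs.v *)
From HB Require Import structures.
From mathcomp Require Export all_boot all_order all_algebra.
From mathcomp Require Export all_classical all_reals all_analysis.
Export numFieldNormedType.Exports.

Set Implicit Arguments.
Unset Strict Implicit.
Unset Printing Implicit Defensive.

Import Order.TTheory GRing.Theory Num.Theory.

Local Open Scope classical_set_scope.
Local Open Scope ring_scope.

(* The library norm on 'rV[R]_d is the sup norm, so the Euclidean structure is
   introduced separately; differentiability and semicontinuity only depend on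
   the topology, which is the same for both norms. *)
Definition dot (R : realType) (d : nat) (u v : 'rV[R]_d) : R :=
  \sum_(j < d) u 0 j * v 0 j.

Definition enorm (R : realType) (d : nat) (u : 'rV[R]_d) : R :=
  Num.sqrt (dot u u).

Definition grad (R : realType) (d : nat) (g : 'rV[R]_d -> R) (x : 'rV[R]_d) :
    'rV[R]_d :=
  \row_(j < d) 'D_(delta_mx 0 j) g x.

Definition upper_smooth (R : realType) (d : nat) (L : R)
    (g : 'rV[R]_d -> R) : Prop :=
  forall x y : 'rV[R]_d,
    g y - g x - dot (grad g x) (y - x) <= L / 2 * enorm (y - x) ^+ 2.

Definition lower_smooth (R : realType) (d : nat) (l : R)
    (g : 'rV[R]_d -> R) : Prop :=
  forall x y : 'rV[R]_d,
    - (l / 2 * enorm (y - x) ^+ 2) <= g y - g x - dot (grad g x) (y - x).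

(* The library's [convex_function] is for real-valued functions only.  In
   [\bar R], 0 * +oo = 0, so the cases t = 0 and t = 1 are harmless. *)
Definition convex_fun (R : realType) (d : nat) (g : 'rV[R]_d -> \bar R) : Prop :=
  forall (x y : 'rV[R]_d) (t : R), 0 <= t <= 1 ->
    (g (t *: x + (1 - t) *: y)%R
       <= t%:E * g x + (1 - t)%R%:E * g y)%E.

Definition proper_fun (R : realType) (d : nat) (g : 'rV[R]_d -> \bar R) : Prop :=
  (forall x, g x <> -oo%E) /\ exists x, g x \is a fin_num.

Definition minimizer (R : realType) (T : Type) (g : T -> \bar R) (x : T) : Prop :=
  forall y, (g x <= g y)%E.

Definition avg_fun (R : realType) (n d : nat) (f_ : 'I_n -> 'rV[R]_d -> R)
    (x : 'rV[R]_d) : R :=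
  n%:R^-1 * \sum_(i < n) f_ i x.

Definition composite (R : realType) (n d : nat) (f_ : 'I_n -> 'rV[R]_d -> R)
    (Psi : 'rV[R]_d -> \bar R) (x : 'rV[R]_d) : \bar R :=
  ((avg_fun f_ x)%:E + Psi x)%E.

(* Computations paired with the number of component gradients they evaluate. *)
Definition counted (A : Type) : Type := (A * nat)%type.

Definition cret (A : Type) (a : A) : counted A := (a, 0%N).

Definition cbind (A B : Type) (p : counted A) (k : A -> counted B) : counted B :=
  let q := k p.1 in (q.1, (p.2 + q.2)%N).

Definition query_component (R : realType) (n d : nat)
    (f_ : 'I_n -> 'rV[R]_d -> R) (i : 'I_n) (x : 'rV[R]_d) :
    counted 'rV[R]_d :=
  (grad (f_ i) x, 1%N).

Definition query_full (R : realType) (n d : nat)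
    (f_ : 'I_n -> 'rV[R]_d -> R) (x : 'rV[R]_d) : counted 'rV[R]_d :=
  (grad (avg_fun f_) x, n).

Definition epoch_len (m0 s : nat) : nat := (2 ^ s * m0)%N.

Definition total_len (m0 S : nat) : nat := \sum_(1 <= s < S.+1) epoch_len m0 s.

Definition step_len (R : realType) (m0 S : nat) (eta : R) (s t : nat) : R :=
  let T := total_len m0 S in
  let k := (\sum_(1 <= r < s) epoch_len m0 r + t)%N in
  eta * Num.sqrt T%:R / Num.sqrt (2 * T%:R - k%:R).

(* An arg min over R^d; the default value 0 would only be returned if there
   were no minimizer. *)
Definition prox_step (R : realType) (d : nat) (Psi : 'rV[R]_d -> \bar R)
    (h : R) (x xi : 'rV[R]_d) : 'rV[R]_d :=
  xget 0 [set y | minimizer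
    (fun z => ((1 / (2 * h) * enorm (x - z) ^+ 2)%R%:E + Psi z
               + (dot xi z)%:E)%E) y].

(* State after t inner iterations of epoch s:
   the iterate x_t^s together with x_0^s + ... + x_{t-1}^s.
   Here idx t is the random index i_t^s. *)
Fixpoint inner_loop (R : realType) (n d : nat) (f_ : 'I_n -> 'rV[R]_d -> R)
    (Psi : 'rV[R]_d -> \bar R) (m0 S : nat) (eta : R) (s : nat)
    (idx : nat -> 'I_n) (xtilde mu x0 : 'rV[R]_d) (t : nat) :
    counted ('rV[R]_d * 'rV[R]_d) :=
  if t is t'.+1 then
    cbind (inner_loop f_ Psi m0 S eta s idx xtilde mu x0 t') (fun st =>
    cbind (query_component f_ (idx t') st.1) (fun g =>
    cbind (query_component f_ (idx t') xtilde) (fun gtilde =>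
    let xi := g - gtilde + mu in
    cret (prox_step Psi (step_len m0 S eta s t'.+1) st.1 xi, st.2 + st.1))))
  else cret (x0, 0).

(* State after s epochs: (xtilde^s, x_0^{s+1}). *)
Fixpoint epochs (R : realType) (n d : nat) (f_ : 'I_n -> 'rV[R]_d -> R)
    (Psi : 'rV[R]_d -> \bar R) (xphi : 'rV[R]_d) (m0 S : nat) (eta : R)
    (idx : nat -> nat -> 'I_n) (s : nat) : counted ('rV[R]_d * 'rV[R]_d) :=
  if s is s'.+1 then
    cbind (epochs f_ Psi xphi m0 S eta idx s') (fun st =>
    cbind (query_full f_ st.1) (fun mu =>
    let m := epoch_len m0 s'.+1 in
    cbind (inner_loop f_ Psi m0 S eta s'.+1 (idx s'.+1) st.1 mu st.2 m)
      (fun st' => cret (m%:R^-1 *: st'.2, st'.1))))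
  else cret (xphi, xphi).

Definition svrg_nc (R : realType) (n d : nat) (f_ : 'I_n -> 'rV[R]_d -> R)
    (Psi : 'rV[R]_d -> \bar R) (xphi : 'rV[R]_d) (m0 S : nat) (eta : R)
    (idx : nat -> nat -> 'I_n) : counted 'rV[R]_d :=
  cbind (epochs f_ Psi xphi m0 S eta idx S) (fun st => cret st.1).

(* The indices i_t^s, 1 <= s <= S and 0 <= t < m_s, are random variables that
   are uniform on 'I_n and mutually independent: the product rule for proper
   subfamilies is the case where the other A s t are [setT]. *)
Definition uniform_indep_indices (R : realType) (disp : measure_display)
    (Omega : measurableType disp) (P : probability Omega R)
    (n m0 S : nat) (I : nat -> nat -> Omega -> 'I_n) : Prop :=
  [/\ forall s t : nat, (1 <= s <= S)%N -> (t < epoch_len m0 s)%N ->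
        forall i : 'I_n, measurable (I s t @^-1` [set i]),
      forall s t : nat, (1 <= s <= S)%N -> (t < epoch_len m0 s)%N ->
        forall i : 'I_n, P (I s t @^-1` [set i]) = (n%:R^-1)%:E
    & forall A : nat -> nat -> set 'I_n,
        P [set w | forall s t : nat, (1 <= s <= S)%N ->
                     (t < epoch_len m0 s)%N -> A s t (I s t w)]
        = (\prod_(1 <= s < S.+1) \prod_(0 <= t < epoch_len m0 s)
             P (I s t @^-1` A s t))%E].

Definition svrg_eta (R : realType) (L l Theta eps : R) : R :=
  if l == 0 then 1 / (13 * L)
  else Num.min (1 / (13 * L))
         (eps / (312 * Num.sqrt 2 * Theta * L * l)).

Definition log2 (R : realType) (x : R) : R := ln x / ln 2.

(* Main.v *)
(* Write a = F - F(xstar), q = |x - xstar|^2, x~ for the snapshot of the previous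
   epoch and h for the step length in use.  Comparing the upper model of f_i at
   x with its lower model at xstar in a suitable third point and averaging over i
   (f is convex) gives
     avg_i |grad f_i(x) - grad f_i(xstar)|^2 <= 2 L a(x) + L l q(x),
   hence a variance bound for the gradient estimator.  With h L <= 1/13 the
   three-point inequality of the proximal step yields, in expectation over i,
     a(x+) + q(x+) / (2h) <= (a(x) + a(x~)) / 6 + c (q(x) + q(x~)) + q(x) / (2h)
   where c = (13/12) eta L l.  The step lengths increase just fast enough that
   1/(2h) drops by at least 3 c per step, which absorbs the terms c q caused by
   nonconvexity.  By convexity the snapshot is no worse than the mean of the
   iterates of its epoch, and epochs double in length, so
     a(x_0) + q(x_0) / (2h) + 2^s m0 (a(x~) / 3 + 2 c q(x~))
   does not increase in expectation from one epoch to the next.  Initially it is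
   O(Theta / eta) = O(eps 2^S m0). *)
Require Import Defs.
From mathcomp Require Import finmap measurable_realfun ring lra zify.
Set Implicit Arguments.
Unset Strict Implicit.
Unset Printing Implicit Defensive.
Import Order.TTheory GRing.Theory Num.Theory.
Local Open Scope classical_set_scope.
Local Open Scope ring_scope.

(** * Smoothness and the variance of gradient differences *)

Section euclidean.
Variables (R : realType) (d : nat).
Implicit Types (u v w : 'rV[R]_d) (a : R).

Lemma dotC u v : dot u v = dot v u.
Proof. by apply: eq_bigr => j _; rewrite mulrC. Qed.

Lemma dotDl u v w : dot (u + v) w = dot u w + dot v w.
Proof.
by rewrite -big_split; apply: eq_bigr => j _; rewrite !mxE mulrDl.
Qed.

Lemma dotZl a u w : dot (a *: u) w = a * dot u w.
Proof. by rewrite /dot mulr_sumr; apply: eq_bigr => j _; rewrite !mxE mulrA. Qed.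

Lemma dotNl u w : dot (- u) w = - dot u w.
Proof. by rewrite -scaleN1r dotZl mulN1r. Qed.

Lemma dotDr u v w : dot w (u + v) = dot w u + dot w v.
Proof. by rewrite dotC dotDl !(dotC w). Qed.

Lemma dotZr a u w : dot w (a *: u) = a * dot w u.
Proof. by rewrite dotC dotZl (dotC w). Qed.

Lemma dotNr u w : dot w (- u) = - dot w u.
Proof. by rewrite dotC dotNl (dotC w). Qed.

Lemma dot0l w : dot 0 w = 0.
Proof. by rewrite -(scale0r 0) dotZl mul0r. Qed.

Lemma dot_suml (I : Type) (r : seq I) (G : I -> 'rV[R]_d) w :
  dot (\sum_(i <- r) G i) w = \sum_(i <- r) dot (G i) w.
Proof.
by elim/big_rec2: _ => [|i y1 y2 _ <-]; rewrite ?dot0l// dotDl.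
Qed.

Lemma dot_ge0 u : 0 <= dot u u.
Proof. by apply: sumr_ge0 => j _; rewrite -expr2 sqr_ge0. Qed.

Lemma enorm_sqr u : enorm u ^+ 2 = dot u u.
Proof. by rewrite sqr_sqrtr// dot_ge0. Qed.

Lemma coord_sqr_le_dot u j : u 0 j ^+ 2 <= dot u u.
Proof.
rewrite /dot (bigD1 j)//= -expr2 lerDl; apply: sumr_ge0 => k _.
by rewrite -expr2 sqr_ge0.
Qed.

Definition dotE := (dotDl, dotDr, dotNl, dotNr, dotZl, dotZr).

Lemma dot_young a u v : 0 < a -> dot u v <= a / 2 * dot u u + dot v v / (2 * a).
Proof.
move=> a0; have := dot_ge0 (a *: u - v); rewrite !dotE (dotC v u) => H.
rewrite -subr_ge0.
have -> : a / 2 * dot u u + dot v v / (2 * a) - dot u v =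
   (a * (a * dot u u) + - (a * dot u v) + (- (a * dot u v) - - dot v v)) / (2 * a).
  by field; rewrite gt_eqF.
apply: divr_ge0; [lra | by rewrite mulr_ge0// ltW].
Qed.

Lemma dot_sqrD_le u v : dot (u + v) (u + v) <= 2 * dot u u + 2 * dot v v.
Proof. by have := dot_ge0 (u - v); rewrite !dotE (dotC v u); lra. Qed.

Lemma dot_sqr_conv a u v : 0 <= a <= 1 ->
  dot (a *: u + (1 - a) *: v) (a *: u + (1 - a) *: v) <=
  a * dot u u + (1 - a) * dot v v.
Proof.
move=> /andP[a0 a1]; have := dot_ge0 (u - v).
rewrite !dotE (dotC v u); move: (dot u u) (dot u v) (dot v v) => x y z H.
have : 0 <= a * (1 - a) * (x - 2 * y + z) by rewrite !mulr_ge0//; lra.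
by lra.
Qed.

End euclidean.

(** Letting [t] tend to 0 isolates the first-order term. Variational inequalities along segments are
    obtained from it below. *)
Lemma ge0_of_small_quadratic (R : realType) (p q : R) :
  (forall t : R, 0 < t <= 1 -> 0 <= t * p + t ^+ 2 * q) -> 0 <= p.
Proof.
move=> H; rewrite leNgt; apply/negP => p0.
have q0 : 0 <= `|q| := normr_ge0 q.
have D0 : 0 < 2 * (`|q| - p) by lra.
(* This choice gives [t * |q| <= - p / 2], hence [p + t * q <= p / 2 < 0]. *)
pose t := - p / (2 * (`|q| - p)).
have t0 : 0 < t by rewrite divr_gt0//; lra.
have tE : t * (2 * (`|q| - p)) = - p by rewrite /t mulfVK// gt_eqF.
have t1 : t <= 1 by nra.
have := H t; rewrite t0 t1 => /(_ isT); rewrite expr2 -mulrA -mulrDr pmulr_rge0//.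
have := ler_norm q => qq; nra.
Qed.

Section gradient_average.
Variables (R : realType) (n d : nat) (f_ : 'I_n -> 'rV[R]_d -> R).

Lemma grad_avg_fun (x : 'rV[R]_d) :
  (forall i, differentiable (f_ i) x) ->
  grad (avg_fun f_) x = n%:R^-1 *: \sum_(i < n) grad (f_ i) x.
Proof.
move=> df; apply/rowP => j; rewrite !mxE.
have dv i : derivable (f_ i) x (delta_mx 0 j) by exact: diff_derivable.
have -> : avg_fun f_ = n%:R^-1 \*o (\sum_(i < n) f_ i).
  by apply/funext => y; rewrite /avg_fun /= fct_sumE.
rewrite deriveMl; last exact: derivable_sum.
by rewrite derive_sum// summxE; congr (_ * _); apply: eq_bigr => i _; rewrite mxE.
Qed.

Hypothesis n_gt0 : (1 <= n)%N.
Hypothesis df : forall i x, differentiable (f_ i) x.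

(** The Bregman remainder is linear in the function, so bounds on the remainders of the [f_ i] pass
    to their average. *)
Lemma avg_bregman (x y : 'rV[R]_d) :
  avg_fun f_ y - avg_fun f_ x - dot (grad (avg_fun f_) x) (y - x) =
  n%:R^-1 * \sum_(i < n) (f_ i y - f_ i x - dot (grad (f_ i) x) (y - x)).
Proof.
rewrite grad_avg_fun// dotZl dot_suml /avg_fun !big_split /= !sumrN.
by rewrite !mulrDr !mulrN.
Qed.

Lemma avg_le (G : 'I_n -> R) (b : R) :
  (forall i, G i <= b) -> n%:R^-1 * \sum_(i < n) G i <= b.
Proof.
move=> Gb; rewrite ler_pdivrMl ?ltr0n//.
apply: le_trans (ler_sum _ (fun i _ => Gb i)) _.
by rewrite sumr_const card_ord mulr_natl.
Qed.

Lemma avg_ge (G : 'I_n -> R) (b : R) :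
  (forall i, b <= G i) -> b <= n%:R^-1 * \sum_(i < n) G i.
Proof.
move=> Gb; rewrite -lerN2 -mulrN -sumrN; apply: avg_le => i.
by rewrite lerN2.
Qed.

Lemma upper_smooth_avg (L : R) :
  (forall i, upper_smooth L (f_ i)) -> upper_smooth L (avg_fun f_).
Proof. by move=> H x y; rewrite avg_bregman; apply: avg_le => i; exact: H. Qed.

Lemma lower_smooth_avg (l : R) :
  (forall i, lower_smooth l (f_ i)) -> lower_smooth l (avg_fun f_).
Proof. by move=> H x y; rewrite avg_bregman; apply: avg_ge => i; exact: H. Qed.

End gradient_average.

Lemma convex_functionP (R : realType) (d : nat) (f : 'rV[R]_d -> R) :
  convex_function setT f -> forall x y (t : R), 0 <= t <= 1 ->
  f (t *: x + (1 - t) *: y) <= t * f x + (1 - t) * f y.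
Proof.
move=> cf x y t /andP[t0 t1].
by have := cf (Itv01 t0 t1) x y; rewrite !in_setT => /(_ isT isT).
Qed.

(** On the segment from [x] to [y], convexity bounds [f] from above and lower smoothness bounds it
    from below by its linear model up to [O(t ^ 2)]. The part linear in [t] is the claim. *)
Lemma convex_bregman_ge0 (R : realType) (d : nat) (f : 'rV[R]_d -> R) (l : R) :
  convex_function setT f -> lower_smooth l f ->
  forall x y, 0 <= f y - f x - dot (grad f x) (y - x).
Proof.
move=> cf lf x y; apply: (@ge0_of_small_quadratic _ _ (l / 2 * dot (y - x) (y - x))).
move=> t /andP[t0 t1].
have := @convex_functionP _ _ _ cf y x t; rewrite (ltW t0) t1 => /(_ isT) cv.
have := lf x (t *: y + (1 - t) *: x).
have -> : t *: y + (1 - t) *: x - x = t *: (y - x).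
  by rewrite scalerBl scale1r addrA addrAC addrK scalerBr.
rewrite enorm_sqr dotZr dotZl dotZr.
move: (dot _ _) (dot _ _) cv => g s; lra.
Qed.

Section smooth_variance.
Variables (R : realType) (d : nat) (L l : R).
Hypotheses (L0 : 0 < L) (l0 : 0 <= l).

(* Compare the upper model at [x] and the lower model at [y] in the point
   x - (v + l (x - y)) / (L + l), where v is the gradient difference. *)
Lemma grad_diff_sqr_le (f : 'rV[R]_d -> R) (x y : 'rV[R]_d) :
  upper_smooth L f -> lower_smooth l f ->
  dot (grad f x - grad f y) (grad f x - grad f y) <=
  2 * (L + l) * (f x - f y - dot (grad f y) (x - y))
    + L * l * dot (x - y) (x - y)
    - 2 * l * dot (grad f x - grad f y) (x - y).
Proof.
move=> uf lf; set v := _ - _; set e := x - y.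
have Ll : 0 < L + l by rewrite ltr_wpDr.
pose u := (L + l)^-1 *: (v + l *: e).
have := uf x (x - u); have := lf y (x - u).
have -> : x - u - x = - u by rewrite addrAC subrr add0r.
have -> : x - u - y = e - u by rewrite addrAC.
rewrite !enorm_sqr => H1 H2.
have gx : grad f x = v + grad f y by rewrite /v subrK.
have H : 0 <= (f x - f y - dot (grad f y) e) - dot v u + L / 2 * dot u u
     + l / 2 * dot (e - u) (e - u).
  move: H1 H2; rewrite gx !(dotDl v) !(dotDr _ _ (grad f y)) !dotNr !dotNl opprK.
  by move: (dot v u) (dot _ u) (dot u u) (dot (e - u) _) => *; lra.
move: H; rewrite /u; set D := f x - f y - _; clearbody v e D.
rewrite !dotE (dotC e v).
move: (dot v v) (dot v e) (dot e e) => vv ve ee H.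
(* The chosen [u] minimizes the quadratic bound [H]; multiplied by [2 * (L + l)], its minimum
   completes the square of [v + l *: e]. *)
have : 0 <= 2 * (L + l) * (D + l / 2 * ee) - (vv + 2 * l * ve + l ^+ 2 * ee).
  move: H; rewrite -(@pmulr_rge0 _ (2 * (L + l))) ?mulr_gt0//.
  by congr (0 <= _); field; rewrite gt_eqF.
by rewrite subr_ge0 => h; nra.
Qed.

(** After averaging, the inner product of the gradient difference of the mean with [x - y] is the
    sum of the two Bregman remainders between [x] and [y]. Both are nonnegative by convexity, so the
    term with factor [- 2 * l] cancels the excess [2 * l] in front of the remainder. *)
Lemma avg_grad_diff_sqr_le (n : nat) (f_ : 'I_n -> 'rV[R]_d -> R) (x y : 'rV[R]_d) :
  (1 <= n)%N -> (forall i x, differentiable (f_ i) x) ->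
  convex_function setT (avg_fun f_) ->
  (forall i, upper_smooth L (f_ i)) -> (forall i, lower_smooth l (f_ i)) ->
  n%:R^-1 * \sum_(i < n)
     dot (grad (f_ i) x - grad (f_ i) y) (grad (f_ i) x - grad (f_ i) y) <=
  2 * L * (avg_fun f_ x - avg_fun f_ y - dot (grad (avg_fun f_) y) (x - y))
  + L * l * dot (x - y) (x - y).
Proof.
move=> n0 df cf uf lf.
have lf' := lower_smooth_avg n0 df lf.
have Dyx := convex_bregman_ge0 cf lf' x y.
apply: (@le_trans _ _ (n%:R^-1 * \sum_(i < n)
   (2 * (L + l) * (f_ i x - f_ i y - dot (grad (f_ i) y) (x - y))
    + L * l * dot (x - y) (x - y) - 2 * l * dot (grad (f_ i) x - grad (f_ i) y) (x - y)))).
  by rewrite ler_pM2l ?invr_gt0 ?ltr0n//; apply: ler_sum => i _; exact: grad_diff_sqr_le.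
rewrite !big_split /= sumrN -!mulr_sumr sumr_const card_ord -dot_suml.
rewrite -(mulr_natl (dot (x - y) (x - y)) n).
have -> : \sum_(i < n) (grad (f_ i) x - grad (f_ i) y) =
    n%:R *: (grad (avg_fun f_) x - grad (avg_fun f_) y).
  by rewrite !grad_avg_fun// -scalerBr scalerA mulfV ?scale1r ?pnatr_eq0 -?lt0n//
    big_split /= sumrN.
have nn : n%:R^-1 * n%:R = 1 :> R by rewrite mulVf// pnatr_eq0 -lt0n.
have w_ge : avg_fun f_ x - avg_fun f_ y - dot (grad (avg_fun f_) y) (x - y)
    <= dot (grad (avg_fun f_) x - grad (avg_fun f_) y) (x - y).
  by move: Dyx; rewrite -(opprB x y) dotNr (dotDl (grad _ x)) dotNl; lra.
rewrite dotZl; move: w_ge; rewrite (avg_bregman df y x).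
move: (dot (grad _ x - _) _) (dot (x - y) _) (\sum_(i < n) _) nn => w s sD nn w_ge.
have -> : n%:R^-1 * (2 * (L + l) * sD + L * l * (n%:R * s) - 2 * l * (n%:R * w)) =
   2 * (L + l) * (n%:R^-1 * sD) + (n%:R^-1 * n%:R) * (L * l * s)
   - (n%:R^-1 * n%:R) * (2 * l * w) by ring.
by rewrite nn !mul1r; have := ler_wpM2l l0 w_ge; lra.
Qed.

End smooth_variance.

(** * The proximal step *)

(** Without a minimum, the open sets where [g] exceeds a real level [a] that some point of [K] does
    not exceed would cover [K]. In a finite subcover take the least level: the point of [K] not
    exceeding it lies in no set of the subcover. *)
Lemma lower_semicontinuous_compact_min (R : realType) (T : ptopologicalType)
    (K : set T) (g : T -> \bar R) :
  compact K -> K !=set0 -> lower_semicontinuous g ->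
  exists2 y, K y & forall z, K z -> (g y <= g z)%E.
Proof.
move=> cK [x0 Kx0] lscg; apply: contrapT => noMin.
have below y : K y -> exists2 a : R, (a%:E < g y)%E & exists2 z, K z & (g z <= a%:E)%E.
  move=> Ky; have [z Kz zy] : exists2 z, K z & (g z < g y)%E.
    apply: contrapT => H; apply: noMin; exists y => // z Kz.
    by rewrite leNgt; apply/negP => zy; apply: H; exists z.
  case: (g y) zy => [r||]; case gz : (g z) => [s||]// zy.
  - by exists s => //; exists z => //; rewrite gz.
  - by exists (r - 1); [rewrite lte_fin ltrBlDr ltrDl|exists z => //; rewrite gz leNye].
  - by exists s; [rewrite ltry|exists z => //; rewrite gz].
  - by exists 0; [rewrite ltry|exists z => //; rewrite gz leNye].
move: cK; rewrite compact_cover => cK.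
have [||D' D'D Dcov] := cK _ [set a : R | exists2 z, K z & (g z <= a%:E)%E]
   (fun a => [set x | (a%:E < g x)%E]).
- by move=> a _; move/lower_semicontinuousP: lscg; exact.
- by move=> y Ky; have [a ay [z Kz za]] := below _ Ky; exists a => //; exists z.
have [a1 a1D _] := Dcov _ Kx0.
have [a aD amin] : exists2 a, a \in D' & forall b, b \in D' -> a <= b.
  pose s := sort <=%R (finmap.enum_fset D').
  have sE b : (b \in s) = (b \in D') by rewrite mem_sort.
  have srt : sorted <=%R s by exact: sort_le_sorted.
  case: s sE srt => [|a s] sE srt; first by move: a1D; rewrite /= -sE.
  exists a; first by rewrite -sE mem_head.
  move=> b; rewrite -sE inE => /predU1P[->//|bs].
  by move: srt; rewrite /= (path_sortedE le_trans) => /andP[/allP/(_ _ bs)].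
have [z Kz za] : [set a : R | exists2 z, K z & (g z <= a%:E)%E] a.
  by apply/set_mem/D'D.
have [b bD] := Dcov _ Kz.
move=> /= bz; have := lt_le_trans bz za; rewrite lte_fin ltNge => /negP; apply.
exact: amin.
Qed.

Lemma continuous_quadratic (R : realType) (d : nat) (a : R) (x w : 'rV[R]_d) :
  continuous (fun z : 'rV[R]_d => a * dot (x - z) (x - z) + dot w z).
Proof.
have sumc (G : 'I_d -> 'rV[R]_d -> R) : (forall j, continuous (G j)) ->
    continuous (fun z => \sum_(j < d) G j z).
  move=> Gc z; apply: (@cvg_big _ _ +%R).
  - exact: add_continuous.
  - exact: nbhs_filter.
  - by move=> j _; exact: Gc.
have cc (j : 'I_d) : continuous (fun z : 'rV[R]_d => z 0 j).
  exact: coord_continuous.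
have c1 : continuous (fun z : 'rV[R]_d => dot (x - z) (x - z)).
  apply: sumc => j y.
  have xy : ((x - z) 0 j @[z --> y] --> (x - y) 0 j).
    have -> : (fun z : 'rV[R]_d => (x - z) 0 j) = (fun z => x 0 j - z 0 j).
      by apply/funext => z; rewrite !mxE.
    have -> : (x - y) 0 j = x 0 j - y 0 j by rewrite !mxE.
    exact: (cvgB (cvg_cst (x 0 j)) (cc j y)).
  exact: (cvgM xy xy).
have c2 : continuous (fun z : 'rV[R]_d => dot w z).
  by apply: sumc => j y; exact: (cvgM (cvg_cst (w 0 j)) (cc j y)).
by move=> z; exact: (cvgD (cvgM (cvg_cst a) (c1 z)) (c2 z)).
Qed.

Lemma lower_semicontinuousD_continuous (R : realType) (T : topologicalType)
    (c : T -> R) (g : T -> \bar R) :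
  continuous c -> lower_semicontinuous g ->
  lower_semicontinuous (fun z => ((c z)%:E + g z)%E).
Proof.
move=> cc lg z a az.
have [b bg ab] : exists2 b : R, (b%:E < g z)%E & a - b < c z.
  move: az; case: (g z) => [r| |].
  (* Each summand gives up half of the slack [c z + r - a]. *)
  - rewrite -EFinD lte_fin => az; exists (r - (c z + r - a) / 2).
      by rewrite lte_fin ltrBlDr ltrDl divr_gt0// subr_gt0.
    by lra.
  - by move=> _; exists (a - c z + 1); [rewrite ltry|lra].
  - by rewrite addeNy ltNge leNye.
have [V Vz Vg] := lg z b bg.
exists (V `&` [set y | a - b < c y]).
  apply: filterI => //.
  exact: (cvgr_gt _ (cc z) _ ab).
move=> y [/Vg by_ /= cy].
have : (a%:E < (c y)%:E + b%:E)%E by rewrite -EFinD lte_fin; lra.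
move/lt_le_trans; apply.
by rewrite leeD2l// ltW.
Qed.

Section prox.
Variables (R : realType) (d : nat) (Psi : 'rV[R]_d -> \bar R).
Hypotheses (Psi_proper : proper_fun Psi) (Psi_convex : convex_fun Psi)
  (Psi_lsc : lower_semicontinuous Psi).

Implicit Types (h t : R) (x xi u v z : 'rV[R]_d).

(** Convertible to the function minimized in [prox_step]. *)
Definition prox_objective (h : R) (x xi z : 'rV[R]_d) : \bar R :=
  ((1 / (2 * h) * enorm (x - z) ^+ 2)%R%:E + Psi z + (dot xi z)%:E)%E.

Lemma prox_objectiveE h x xi z : prox_objective h x xi z =
  ((1 / (2 * h) * dot (x - z) (x - z) + dot xi z)%:E + Psi z)%E.
Proof. by rewrite /prox_objective enorm_sqr addeAC EFinD. Qed.

Variables (x0 g : 'rV[R]_d).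
Hypothesis Psi_x0 : Psi x0 \is a fin_num.
(** An affine minorant of [Psi], exact at [x0], makes the proximal objective coercive. It is
    instantiated with [x0 = xstar] and [g = - grad f xstar]. *)
Hypothesis Psi_minorant :
  forall u, (Psi x0 + (dot g (u - x0))%:E <= Psi u)%E.

Lemma prox_objective_coercive h x xi : 0 < h -> exists2 r : R, 0 <= r &
  forall z, r < dot (x - z) (x - z) ->
    (prox_objective h x xi x0 < prox_objective h x xi z)%E.
Proof.
move=> h0; set w := xi + g.
pose M := 1 / (2 * h) * dot (x - x0) (x - x0) + dot xi x0.
(* Young's inequality spends half of the quadratic term on [dot w (x - z)]. The objective at [z]
   minus [Psi x0] is then at least [dot (x - z) (x - z) / (4 * h) + c], while at [x0] it equals
   [M]. *)
pose c := - dot g x0 + dot w x - h * dot w w.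
exists (4 * h * `|M - c|); first by rewrite !mulr_ge0// ltW.
move=> z rz; rewrite !prox_objectiveE -/M.
apply: (@lt_le_trans _ _ ((1 / (2 * h) * dot (x - z) (x - z) + dot xi z)%:E
   + (Psi x0 + (dot g (z - x0))%:E))%E); last by rewrite leeD2l.
rewrite -(fineK Psi_x0) -!EFinD lte_fin.
have yg := @dot_young _ _ (1 / (2 * h)) (x - z) w.
have h20 : 0 < 1 / (2 * h) by rewrite divr_gt0// mulr_gt0.
have := yg h20.
have -> : 1 / (2 * h) / 2 * dot (x - z) (x - z) + dot w w / (2 * (1 / (2 * h)))
   = (4 * h)^-1 * dot (x - z) (x - z) + h * dot w w by field; rewrite gt_eqF.
have -> : 1 / (2 * h) * dot (x - z) (x - z) = 2 * ((4 * h)^-1 * dot (x - z) (x - z)).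
  by field; rewrite gt_eqF.
have : M - c < (4 * h)^-1 * dot (x - z) (x - z).
  rewrite mulrC ltr_pdivlMr ?mulr_gt0//; apply: le_lt_trans rz.
  by rewrite mulrC ler_pM2l ?mulr_gt0// ler_norm.
rewrite /c (dotC (x - z) w) /w !dotE.
move: ((4 * h)^-1 * _) => N.
move: (h * _); clear; move=> *; lra.
Qed.

(** A minimizer exists on a compact box around [x]. By coercivity the objective outside the box
    exceeds its value at [x0], which lies in the box, so this minimizer is global and [xget] does
    not fall back on its default. *)
Lemma prox_step_minimizer h x xi : 0 < h ->
  minimizer (prox_objective h x xi) (prox_step Psi h x xi).
Proof.
move=> h0; apply: (@xgetPex _ 0 [set y | minimizer (prox_objective h x xi) y]).
have [r1 r1_ge0 coer] := prox_objective_coercive x xi h0.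
(* The second summand puts [x0] into the box. The half-width [r + 1] below works because
   [r <= (r + 1) ^ 2]. *)
pose r := r1 + dot (x - x0) (x - x0).
have r1r : r1 <= r by rewrite lerDl dot_ge0.
have r0 : 0 <= r by exact: le_trans r1r.
pose K := [set v : 'rV[R]_d | forall j,
  (`[x 0 j - (r + 1), x 0 j + (r + 1)]%classic : set R) (v 0 j)].
have cK : compact K.
  apply: (@rV_compact R d (fun j => `[x 0 j - (r + 1), x 0 j + (r + 1)]%classic)).
  by move=> j; exact: segment_compact.
have outside z : ~ K z -> r < dot (x - z) (x - z).
  move=> nKz; rewrite ltNge; apply/negP => xz; apply: nKz => j /=.
  have := le_trans (coord_sqr_le_dot (x - z) j) xz.
  rewrite !mxE in_itv /= => H.
  have : `|x 0 j - z 0 j| <= r + 1.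
    rewrite -(@ler_sqr R) ?nnegrE//; last lra.
    by rewrite real_normK ?num_real//; nra.
  by rewrite ler_norml => /andP[? ?]; apply/andP; split; lra.
have Kx : K x by move=> j /=; rewrite in_itv /=; apply/andP; split; lra.
have [||y Ky ymin] := @lower_semicontinuous_compact_min R 'rV[R]_d K (prox_objective h x xi) cK.
- by exists x.
- rewrite (_ : prox_objective h x xi = fun z =>
    ((1 / (2 * h) * dot (x - z) (x - z) + dot xi z)%:E + Psi z)%E); last first.
    by apply/funext => z; rewrite prox_objectiveE.
  by apply: lower_semicontinuousD_continuous => //; exact: continuous_quadratic.
have Kx0 : K x0.
  apply: contrapT => /outside; rewrite /r.
  by move: (dot _ _) => ? ?; lra.
exists y => z; case: (pselect (K z)) => [/ymin//|nKz].
apply: le_trans (ymin _ Kx0) _; apply/ltW/coer.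
exact: le_lt_trans r1r (outside _ nKz).
Qed.

Lemma prox_step_fin_num h x xi : 0 < h -> Psi (prox_step Psi h x xi) \is a fin_num.
Proof.
move=> h0; have := prox_step_minimizer x xi h0 x0; rewrite !prox_objectiveE.
set y := prox_step _ _ _ _; have := Psi_proper.1 y.
by rewrite -(fineK Psi_x0); case: (Psi y).
Qed.

Lemma convex_fin_num u v (t : R) : 0 <= t <= 1 ->
  Psi u \is a fin_num -> Psi v \is a fin_num ->
  Psi (t *: u + (1 - t) *: v) \is a fin_num /\
  fine (Psi (t *: u + (1 - t) *: v)) <= t * fine (Psi u) + (1 - t) * fine (Psi v).
Proof.
move=> t01 uf vf; have := Psi_convex u v t01; have := Psi_proper.1 (t *: u + (1 - t) *: v).
rewrite -(fineK uf) -(fineK vf) -!EFinM -EFinD /=.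
by case: (Psi (_ + _)) => //= r _; rewrite lee_fin.
Qed.

(** Compare the minimizer [y] with [t *: u + (1 - t) *: y] and bound [Psi] there by convexity; the
    part linear in [t] is the claim. *)
Lemma prox_three_point h x xi u : 0 < h -> Psi u \is a fin_num ->
  forall y, y = prox_step Psi h x xi ->
  fine (Psi y) + dot xi (y - u) - fine (Psi u) <=
  (dot (x - u) (x - u) - dot (y - u) (y - u) - dot (y - x) (y - x)) / (2 * h).
Proof.
move=> h0 uf y yE.
have yf : Psi y \is a fin_num by rewrite yE; exact: prox_step_fin_num.
have ymin := prox_step_minimizer x xi h0.
rewrite -yE in ymin.
rewrite -subr_ge0.
apply: (@ge0_of_small_quadratic _ _ (1 / (2 * h) * dot (u - y) (u - y))).
move=> t /andP[t0 t1].
have [|zf zle] := @convex_fin_num u y t _ uf yf; first by rewrite ltW.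
have := ymin (t *: u + (1 - t) *: y); rewrite !prox_objectiveE.
rewrite -(fineK yf) -(fineK zf) -!EFinD lee_fin.
have -> : x - (t *: u + (1 - t) *: y) = (x - y) - t *: (u - y).
  by rewrite scalerBl scale1r scalerBr; apply/rowP => j; rewrite !mxE; ring.
have -> : x - u = (x - y) - (u - y) by rewrite opprB addrA subrK.
have -> : y - x = - (x - y) by rewrite opprB.
have -> : y - u = - (u - y) by rewrite opprB.
have -> : t *: u + (1 - t) *: y = y + t *: (u - y).
  by rewrite scalerBl scale1r scalerBr; apply/rowP => j; rewrite !mxE; ring.
move: zle; have -> : t *: u + (1 - t) *: y = y + t *: (u - y).
  by rewrite scalerBl scale1r scalerBr; apply/rowP => j; rewrite !mxE; ring.
move: (x - y) (u - y) => a b.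
rewrite !dotE (dotC b a).
move: (dot a a) (dot a b) (dot b b) (dot xi y) (dot xi b) => aa ab bb xy xb.
move: (fine (Psi y)) (fine (Psi (y + _))) (fine (Psi u)) => py pz pu zle H.
have -> : t * ((aa - ab + (- ab - - bb) - - - bb - - - aa) / (2 * h) - (py - xb - pu))
   = t * (pu - py + xb) - t * (ab / h).
  by field; rewrite gt_eqF.
have : 1 / (2 * h) * (aa - t * ab + (- (t * ab) - - (t * (t * bb)))) =
   1 / (2 * h) * aa - t * (ab / h) + t ^+ 2 * (1 / (2 * h) * bb).
  by field; rewrite gt_eqF.
lra.
Qed.
End prox.

(** * One step of the method *)

(** Deviations from the mean cancel, and the variance is at most the second moment. *)
Lemma sum_dot_centered_le (R : realType) (n d : nat) (v : 'I_n -> 'rV[R]_d) :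
  (1 <= n)%N -> let m := n%:R^-1 *: \sum_(i < n) v i in
  \sum_(i < n) (m - v i) = 0 /\
  \sum_(i < n) dot (m - v i) (m - v i) <= \sum_(i < n) dot (v i) (v i).
Proof.
move=> n0 m.
have nm : n%:R *: m = \sum_(i < n) v i.
  by rewrite scalerA mulfV ?scale1r// pnatr_eq0 -lt0n.
clearbody m; split.
  by rewrite big_split /= sumr_const card_ord sumrN -scaler_nat nm subrr.
have -> : \sum_(i < n) dot (m - v i) (m - v i) =
   \sum_(i < n) (dot m m - 2 * dot (v i) m + dot (v i) (v i)).
  by apply: eq_bigr => i _; rewrite !dotE (dotC m (v i)); ring.
rewrite !big_split /= sumrN -mulr_sumr sumr_const card_ord -dot_suml -nm dotZl.
rewrite -(mulr_natl (dot m m) n) gerDr.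
by have := mulr_ge0 (ler0n R n) (dot_ge0 m); lra.
Qed.

Section problem.
Variables (R : realType) (n d : nat) (f_ : 'I_n -> 'rV[R]_d -> R)
  (Psi : 'rV[R]_d -> \bar R) (L l : R) (xstar : 'rV[R]_d).
Hypotheses (n_gt0 : (1 <= n)%N) (df : forall i x, differentiable (f_ i) x)
  (Psi_proper : proper_fun Psi) (Psi_convex : convex_fun Psi)
  (Psi_lsc : lower_semicontinuous Psi)
  (L_gt0 : 0 < L) (l_ge0 : 0 <= l)
  (f_convex : convex_function setT (avg_fun f_))
  (f_upper : forall i, upper_smooth L (f_ i))
  (f_lower : forall i, lower_smooth l (f_ i))
  (xstar_min : minimizer (composite f_ Psi) xstar).
Local Notation f := (avg_fun f_).
Local Notation dom x := (Psi x \is a fin_num).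
Implicit Types (x y u xi : 'rV[R]_d) (h t : R).

Lemma minimizer_dom : dom xstar.
Proof.
have [z zf] := Psi_proper.2; have := xstar_min z.
rewrite /composite -(fineK zf) -EFinD; have := Psi_proper.1 xstar.
by case: (Psi xstar).
Qed.

Definition gap x : R := f x + fine (Psi x) - (f xstar + fine (Psi xstar)).
Definition sqdist x : R := dot (x - xstar) (x - xstar).

Lemma composite_gap x : dom x ->
  (composite f_ Psi x - composite f_ Psi xstar)%E = (gap x)%:E.
Proof.
move=> xf; rewrite /composite -(fineK xf) -(fineK minimizer_dom).
by rewrite -!EFinD.
Qed.

Lemma gap_ge0 x : dom x -> 0 <= gap x.
Proof.
move=> xf; have := xstar_min x; rewrite /composite.
by rewrite -(fineK xf) -(fineK minimizer_dom) -!EFinD lee_fin subr_ge0.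
Qed.

Lemma sqdist_ge0 x : 0 <= sqdist x. Proof. exact: dot_ge0. Qed.

(** First-order optimality: [- grad f xstar] is a subgradient of [Psi] at [xstar]. Minimality is
    tested on the segment to [u], with [f] bounded by its upper model. *)
Lemma minimizer_minorant u :
  (Psi xstar + (dot (- grad f xstar) (u - xstar))%:E <= Psi u)%E.
Proof.
case uE : (Psi u) => [r| |].
- have uf : dom u by rewrite uE.
  suff : 0 <= fine (Psi u) - fine (Psi xstar) + dot (grad f xstar) (u - xstar).
    rewrite uE -(fineK minimizer_dom) -EFinD lee_fin dotNl /=; lra.
  apply: (@ge0_of_small_quadratic _ _ (L / 2 * sqdist u)) => t /andP[t0 t1].
  have [|zf zle] := convex_fin_num Psi_proper Psi_convex (t := t) _ uf minimizer_dom.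
    by rewrite ltW.
  have := gap_ge0 zf; rewrite /gap.
  have := upper_smooth_avg n_gt0 df f_upper xstar (t *: u + (1 - t) *: xstar).
  have -> : t *: u + (1 - t) *: xstar - xstar = t *: (u - xstar).
    by rewrite scalerBl scale1r addrA addrAC addrK scalerBr.
  rewrite enorm_sqr dotZr dotZl dotZr /sqdist.
  move: zle; move: (dot _ _) (dot _ _) (f _) (fine _) (fine _) => *; lra.
- by rewrite leey.
- by have := Psi_proper.1 u; rewrite uE.
Qed.

Lemma bregman_le_gap x : dom x ->
  f x - f xstar - dot (grad f xstar) (x - xstar) <= gap x.
Proof.
move=> xf; have := minimizer_minorant x.
rewrite -(fineK xf) -(fineK minimizer_dom) -EFinD lee_fin dotNl /gap.
by move: (dot _ _) => *; lra.
Qed.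

Lemma avg_grad_diff_minimizer x : dom x ->
  n%:R^-1 * \sum_(i < n)
     dot (grad (f_ i) x - grad (f_ i) xstar) (grad (f_ i) x - grad (f_ i) xstar) <=
  2 * L * gap x + L * l * sqdist x.
Proof.
move=> xf; apply: le_trans (avg_grad_diff_sqr_le L_gt0 l_ge0 _ _ n_gt0 df
  f_convex f_upper f_lower) _.
by rewrite lerD2r ler_pM2l ?mulr_gt0//; exact: bregman_le_gap.
Qed.

Definition svrg_step h x xt (i : 'I_n) : 'rV[R]_d :=
  prox_step Psi h x (grad (f_ i) x - grad (f_ i) xt + grad f xt).

Lemma svrg_step_dom h x xt i : 0 < h -> dom (svrg_step h x xt i).
Proof.
move=> h0.
exact: (prox_step_fin_num Psi_proper Psi_lsc minimizer_dom minimizer_minorant).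
Qed.

(** Here [e] is the error of the gradient estimator. Add the three-point inequality at [xstar], the
    upper model of [f] from [x] to the new point, and convexity of [f] between [x] and [xstar]. *)
Lemma svrg_step_descent h x xt i e : 0 < h -> h * L <= 1 / 13 ->
  e = grad f x - (grad (f_ i) x - grad (f_ i) xt + grad f xt) ->
  gap (svrg_step h x xt i) + sqdist (svrg_step h x xt i) / (2 * h) <=
  dot e (x - xstar) + 13 / 24 * h * dot e e + sqdist x / (2 * h).
Proof.
move=> h0 hL; set xi := _ + grad f xt => eE; set y := svrg_step _ _ _ _.
have := prox_three_point Psi_proper Psi_convex Psi_lsc minimizer_dom
  minimizer_minorant h0 minimizer_dom (erefl : y = prox_step Psi h x xi).
have := upper_smooth_avg n_gt0 df f_upper x y.
have := convex_bregman_ge0 f_convex (lower_smooth_avg n_gt0 df f_lower) x xstar.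
(* With this parameter Young's inequality costs [6 / 13] of [|y - x| ^ 2 / h], and smoothness costs
   [1 / 26] since [h * L <= 1 / 13]. Together this is the [1 / 2] that the three-point inequality
   supplies. *)
have h13 : 0 < 13 / 12 * h by rewrite mulr_gt0.
have := dot_young e (y - x) h13.
have -> : dot (y - x) (y - x) / (2 * (13 / 12 * h)) = 6 / 13 * (dot (y - x) (y - x) / h).
  by field; rewrite gt_eqF.
rewrite enorm_sqr /gap -/(sqdist x) -/(sqdist y).
have -> : xi = grad f x - e by rewrite eE opprB addrC subrK.
have -> : y - xstar = (y - x) + (x - xstar) by rewrite addrA subrK.
rewrite -(opprB x xstar) dotNr.
have : L / 2 * dot (y - x) (y - x) <= 1 / 26 * (dot (y - x) (y - x) / h).
  rewrite -[X in _ <= X]mulrA -subr_ge0.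
  have -> : 1 * (26^-1 * (dot (y - x) (y - x) / h)) - L / 2 * dot (y - x) (y - x) =
     (1 / 13 - h * L) * dot (y - x) (y - x) / (2 * h).
    by field; rewrite gt_eqF.
  by apply: divr_ge0; rewrite mulr_ge0 ?dot_ge0 ?subr_ge0// ltW.
move: (dot (y - x) (y - x)) => N.
clearbody y.
rewrite !(dotDl (grad f x)) !dotNl !dotDr.
have -> : (sqdist x - sqdist y - N) / (2 * h) =
  sqdist x / (2 * h) - sqdist y / (2 * h) - 1 / 2 * (N / h).
  by field; rewrite gt_eqF.
have -> : 13 / 12 * h / 2 * dot e e = 13 / 24 * h * dot e e by field.
move: (13 / 24 * h * dot e e) (N / h) (sqdist x / _) (sqdist y / _) (L / 2 * _) => *.
lra.
Qed.

(** The errors [m - v i] sum to zero, which removes the linear term. Their variance is at most the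
    second moment of [v i], which is split at [xstar] into contributions of [x] and [xt]. *)
Lemma svrg_step_expected h x xt : 0 < h -> h * L <= 1 / 13 -> dom x -> dom xt ->
  n%:R^-1 * \sum_(i < n)
    (gap (svrg_step h x xt i) + sqdist (svrg_step h x xt i) / (2 * h)) <=
  (gap x + gap xt) / 6 + 13 / 12 * h * L * l * (sqdist x + sqdist xt)
  + sqdist x / (2 * h).
Proof.
move=> h0 hL xf xtf.
have ninv : 0 < n%:R^-1 :> R by rewrite invr_gt0 ltr0n.
have nn : n%:R^-1 * n%:R = 1 :> R by rewrite mulVf// pnatr_eq0 -lt0n.
pose v i := grad (f_ i) x - grad (f_ i) xt.
pose m := n%:R^-1 *: \sum_(i < n) v i.
have eE i : grad f x - (grad (f_ i) x - grad (f_ i) xt + grad f xt) = m - v i.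
  rewrite /m /v !grad_avg_fun// big_split /= sumrN scalerDr scalerN.
  by rewrite (opprD (_ - _)) addrA addrAC.
have [e0 ev] : \sum_(i < n) (m - v i) = 0 /\
  \sum_(i < n) dot (m - v i) (m - v i) <= \sum_(i < n) dot (v i) (v i).
  exact: sum_dot_centered_le.
pose V z := \sum_(i < n)
  dot (grad (f_ i) z - grad (f_ i) xstar) (grad (f_ i) z - grad (f_ i) xstar).
have vV : \sum_(i < n) dot (v i) (v i) <= 2 * V x + 2 * V xt.
  rewrite !mulr_sumr -big_split /=; apply: ler_sum => i _.
  have -> : v i = (grad (f_ i) x - grad (f_ i) xstar) + - (grad (f_ i) xt - grad (f_ i) xstar).
    by apply/rowP => j; rewrite !mxE; ring.
  by apply: le_trans (dot_sqrD_le _ _) _; rewrite dotNl dotNr opprK.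
have Vx : n%:R^-1 * V x <= 2 * L * gap x + L * l * sqdist x.
  exact: avg_grad_diff_minimizer.
have Vxt : n%:R^-1 * V xt <= 2 * L * gap xt + L * l * sqdist xt.
  exact: avg_grad_diff_minimizer.
apply: (@le_trans _ _ (n%:R^-1 * \sum_(i < n)
  (dot (m - v i) (x - xstar) + 13 / 24 * h * dot (m - v i) (m - v i) + sqdist x / (2 * h)))).
  by rewrite ler_pM2l//; apply: ler_sum => i _; apply: svrg_step_descent.
rewrite !big_split /= -dot_suml e0 dot0l -mulr_sumr sumr_const card_ord add0r.
rewrite -(mulr_natl (sqdist x / (2 * h)) n) mulrDr [n%:R^-1 * (n%:R * _)]mulrA nn mul1r.
apply: lerD => //.
have gx := gap_ge0 xf; have gxt := gap_ge0 xtf.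
move: (\sum_(i < n) dot (m - v i) _) (V x) (V xt) (le_trans ev vV) Vx Vxt.
move=> D B C DV Vx Vxt.
have DBC : n%:R^-1 * D <= 2 * (n%:R^-1 * B) + 2 * (n%:R^-1 * C).
  by rewrite [2 * _]mulrCA [X in _ + X]mulrCA -mulrDr ler_pM2l.
have k0 : 0 <= 13 / 24 * h by rewrite mulr_ge0// ltW.
(* The coefficient of the gaps is [13 / 24 * h * 4 * L], at most [1 / 6]; that of the squared
   distances is [13 / 24 * h * 2 * L * l]. *)
have := ler_wpM2l k0 (le_trans DBC (lerD (ler_wpM2l (ler0n R 2) Vx) (ler_wpM2l (ler0n R 2) Vxt))).
have := ler_wpM2r (addr_ge0 gx gxt) hL.
rewrite [n%:R^-1 * (_ * D)]mulrCA.
move: (n%:R^-1 * D) (gap x) (gap xt) (sqdist x) (sqdist xt) => ? ? ? ? ?.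
lra.
Qed.
End problem.

(** * The run of the algorithm *)

(** Jensen's inequality for equal weights. [D] will be the effective domain of [Psi]: where [Psi] is
    infinite, [fine] returns 0 and convexity of [gap] may fail. *)
Lemma jensen_mean (R : realType) (d : nat) (D : 'rV[R]_d -> Prop)
    (G : 'rV[R]_d -> R) (z : nat -> 'rV[R]_d) (m : nat) :
  (forall u v t, 0 <= t <= 1 -> D u -> D v ->
     D (t *: u + (1 - t) *: v) /\
     G (t *: u + (1 - t) *: v) <= t * G u + (1 - t) * G v) ->
  (0 < m)%N -> (forall t, (t < m)%N -> D (z t)) ->
  D (m%:R^-1 *: \sum_(t < m) z t) /\
  m%:R * G (m%:R^-1 *: \sum_(t < m) z t) <= \sum_(t < m) G (z t).
Proof.
move=> Gcv; elim: m => // -[|m] IH _ Dz.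
  by rewrite !big_ord1 invr1 scale1r mul1r; split=> //; exact: Dz.
have [//|t tm|Dm Gm] := IH; first by apply: Dz; rewrite ltnW.
rewrite !(big_ord_recr m.+1) /=.
set u := _ *: _ in Dm Gm.
have m1 : 0 < m.+1%:R :> R by [].
have m2 : 0 < m.+2%:R :> R by [].
have m2E : m.+2%:R = m.+1%:R + 1 :> R by rewrite -[m.+2]addn1 natrD.
pose t : R := m.+1%:R / m.+2%:R.
have t01 : 0 <= t <= 1.
  by rewrite divr_ge0//= ler_pdivrMr// mul1r ler_nat.
have tE : 1 - t = m.+2%:R^-1.
  apply: (mulIf (lt0r_neq0 m2)).
  by rewrite mulVf ?gt_eqF// mulrBl mul1r /t mulfVK ?gt_eqF// m2E addrAC subrr add0r.
have -> : m.+2%:R^-1 *: (\sum_(i < m.+1) z i + z m.+1) = t *: u + (1 - t) *: z m.+1.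
  by rewrite tE scalerDr /u scalerA /t mulrAC mulfV ?mul1r// gt_eqF.
have [Dt Gt] := Gcv u (z m.+1) t t01 Dm (Dz _ (ltnSn _)).
split=> //; apply: le_trans (ler_wpM2l (ltW m2) Gt) _.
have tm : m.+2%:R * t = m.+1%:R by rewrite mulrC mulfVK// gt_eqF.
rewrite mulrDr [_ * (t * _)]mulrA tm [_ * ((1 - t) * _)]mulrA tE.
by rewrite mulfV ?gt_eqF// mul1r lerD2r.
Qed.

Section coordinate_average.
Variables (R : realType) (V : finType) (n : nat) (v : V).
Hypothesis n_gt0 : (1 <= n)%N.
Implicit Types (phi : {ffun V -> 'I_n}) (i : 'I_n).

Definition set_coord phi i : {ffun V -> 'I_n} :=
  [ffun u => if u == v then i else phi u].

(* (phi, i) |-> (phi[v := i], phi v) is an involution. *)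
Lemma sum_coord_avg (h : {ffun V -> 'I_n} -> 'I_n -> R) :
  (forall phi i j, h (set_coord phi i) j = h phi j) ->
  \sum_phi h phi (phi v) = \sum_phi n%:R^-1 * \sum_i h phi i.
Proof.
move=> hv; pose swap (p : {ffun V -> 'I_n} * 'I_n) := (set_coord p.1 p.2, p.1 v).
have swapK : involutive swap.
  case=> phi i; rewrite /swap /=; congr pair; last by rewrite ffunE eqxx.
  by apply/ffunP => u; rewrite !ffunE; case: eqP => [->|].
have E : \sum_phi \sum_i h phi i = n%:R * \sum_phi h phi (phi v).
  rewrite pair_big /= (reindex_inj (inv_inj swapK)) /=.
  rewrite (eq_bigr (fun p => h p.1 (p.1 v))); last by move=> p _; exact: hv.
  rewrite -(pair_bigA _ (fun phi i => h phi (phi v))) /= mulr_sumr.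
  by apply: eq_bigr => phi _; rewrite sumr_const card_ord mulr_natl.
by rewrite -mulr_sumr E mulrA mulVf ?mul1r// pnatr_eq0 -lt0n.
Qed.

End coordinate_average.

Section run.
Variables (R : realType) (n d : nat) (f_ : 'I_n -> 'rV[R]_d -> R)
  (Psi : 'rV[R]_d -> \bar R) (xphi : 'rV[R]_d) (m0 S : nat) (eta : R).
Local Notation f := (avg_fun f_).
Implicit Types (idx : nat -> nat -> 'I_n) (s t : nat).

Definition snapshot idx s : 'rV[R]_d := (epochs f_ Psi xphi m0 S eta idx s).1.1.

(** The epoch number is shifted by one: epoch [s.+1] uses the reference point [snapshot idx s]. *)
Definition inner_state idx s t : 'rV[R]_d * 'rV[R]_d :=
  (inner_loop f_ Psi m0 S eta s.+1 (idx s.+1) (snapshot idx s)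
     (grad f (snapshot idx s)) (epochs f_ Psi xphi m0 S eta idx s).1.2 t).1.

(* [iterate idx s t] is the iterate x_t^(s+1). *)
Definition iterate idx s t : 'rV[R]_d := (inner_state idx s t).1.

Lemma inner_state_sum idx s t :
  (inner_state idx s t).2 = \sum_(r < t) iterate idx s r.
Proof.
elim: t => [|t IH]; first by rewrite big_ord0.
by rewrite big_ord_recr /= -IH.
Qed.

Lemma snapshotS idx s : snapshot idx s.+1 =
  (epoch_len m0 s.+1)%:R^-1 *: \sum_(t < epoch_len m0 s.+1) iterate idx s t.
Proof. by rewrite -inner_state_sum. Qed.

Lemma iterate_epochS idx s :
  iterate idx s.+1 0 = iterate idx s (epoch_len m0 s.+1).
Proof. by []. Qed.

Lemma iterate0 idx : iterate idx 0 0 = xphi. Proof. by []. Qed.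

Lemma snapshot0 idx : snapshot idx 0 = xphi. Proof. by []. Qed.

Lemma iterateS idx s t : iterate idx s t.+1 =
  svrg_step f_ Psi (step_len m0 S eta s.+1 t.+1) (iterate idx s t) (snapshot idx s)
    (idx s.+1 t).
Proof. by []. Qed.

Lemma epochs_ext idx idx' s :
  (forall r t, (1 <= r <= s)%N -> (t < epoch_len m0 r)%N -> idx r t = idx' r t) ->
  epochs f_ Psi xphi m0 S eta idx s = epochs f_ Psi xphi m0 S eta idx' s.
Proof.
have inner_ext sd (i i' : nat -> 'I_n) xt mu x0 t :
    (forall r, (r < t)%N -> i r = i' r) ->
    inner_loop f_ Psi m0 S eta sd i xt mu x0 t = inner_loop f_ Psi m0 S eta sd i' xt mu x0 t.
  (* Naming one iteration lets [stepE] hold by conversion and keeps the rewriting from unfolding the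
     loop. *)
  pose step r c j := cbind c (fun st : 'rV[R]_d * 'rV[R]_d =>
    cbind (query_component f_ j st.1) (fun g =>
    cbind (query_component f_ j xt) (fun gtilde =>
    cret (prox_step Psi (step_len m0 S eta sd r.+1) st.1 (g - gtilde + mu),
      st.2 + st.1)))).
  have stepE k r : inner_loop f_ Psi m0 S eta sd k xt mu x0 r.+1 =
    step r (inner_loop f_ Psi m0 S eta sd k xt mu x0 r) (k r) by [].
  elim: t => [//|t IH] ii; rewrite !stepE ii// IH// => r rt.
  by rewrite ii// ltnS ltnW.
pose step r c i := cbind c (fun st : 'rV[R]_d * 'rV[R]_d =>
    cbind (query_full f_ st.1) (fun mu =>
    cbind (inner_loop f_ Psi m0 S eta r.+1 i st.1 mu st.2 (epoch_len m0 r.+1))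
      (fun st' => cret ((epoch_len m0 r.+1)%:R^-1 *: st'.2, st'.1)))).
have stepE k r : epochs f_ Psi xphi m0 S eta k r.+1 =
    step r (epochs f_ Psi xphi m0 S eta k r) (k r.+1) by [].
elim: s => [//|s IH] ii; rewrite !stepE IH => [|r t /andP[r1 rs] rt]; last first.
  by rewrite ii// r1 leqW.
rewrite /step; congr cbind; apply/funext => st; congr cbind; apply/funext => mu.
by rewrite (inner_ext _ _ (idx' s.+1))// => r rs; rewrite ii//= leqnn.
Qed.

Lemma snapshot_ext idx idx' s :
  (forall r t, (1 <= r <= s)%N -> (t < epoch_len m0 r)%N -> idx r t = idx' r t) ->
  snapshot idx s = snapshot idx' s.
Proof. by move=> ii; rewrite /snapshot (epochs_ext ii). Qed.

(** The iterate and its snapshot depend only on indices drawn earlier; this permits averaging over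
    the current index with both held fixed. *)
Lemma iterate_ext idx idx' s t :
  (forall r q, (1 <= r)%N -> (q < epoch_len m0 r)%N ->
     (r <= s)%N \/ r = s.+1 /\ (q < t)%N -> idx r q = idx' r q) ->
  (t <= epoch_len m0 s.+1)%N ->
  iterate idx s t = iterate idx' s t /\ snapshot idx s = snapshot idx' s.
Proof.
move=> ii; have E : epochs f_ Psi xphi m0 S eta idx s = epochs f_ Psi xphi m0 S eta idx' s.
  by apply: epochs_ext => r q /andP[r1 rs] qr; apply: ii => //; left.
have sE : snapshot idx s = snapshot idx' s by rewrite /snapshot E.
elim: t ii => [|t IH] ii tm; first by rewrite /iterate /inner_state /= E.
have [|xE _] := IH _ (ltnW tm).
  by move=> r q r1 qr [rs|[rs qt]]; apply: ii => //; [left|right; rewrite ltnS ltnW].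
split; last exact: sE.
by rewrite (iterateS idx) (iterateS idx') xE sE ii//; right.
Qed.

Lemma svrg_nc_snapshot idx :
  (svrg_nc f_ Psi xphi m0 S eta idx).1 = snapshot idx S.
Proof. by []. Qed.

(** One full gradient per epoch and two component gradients per inner iteration. *)
Lemma svrg_nc_cost idx :
  (svrg_nc f_ Psi xphi m0 S eta idx).2 = (S * n + 2 * total_len m0 S)%N.
Proof.
have cost_inner sd (i : nat -> 'I_n) xt mu x0 t :
    (inner_loop f_ Psi m0 S eta sd i xt mu x0 t).2 = (2 * t)%N.
  by elim: t => //= t ->; lia.
have H s : (epochs f_ Psi xphi m0 S eta idx s).2 =
    (s * n + 2 * \sum_(1 <= r < s.+1) epoch_len m0 r)%N.
  elim: s => [|s IH]; first by rewrite big_geq.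
  by rewrite big_nat_recr//= IH cost_inner; lia.
by rewrite /svrg_nc /= addn0 H.
Qed.

End run.

(** * Decrease of the potential along epochs *)

Section sample_paths.
Variables (m0 S : nat).

Definition index_pairs : seq (nat * nat) :=
  [seq (s, t) | s <- iota 1 S, t <- iota 0 (epoch_len m0 s)].

Lemma mem_index_pairs s t :
  ((s, t) \in index_pairs) = (1 <= s <= S)%N && (t < epoch_len m0 s)%N.
Proof.
apply/allpairsPdep/idP => [[s' [t' []]]|/andP[s1 tm]].
  by rewrite !mem_iota => s1 tm [-> ->]; lia.
by exists s, t; rewrite !mem_iota; split=> //; lia.
Qed.

Variable n : nat.
Hypothesis n_gt0 : (1 <= n)%N.

(** The algorithm reads finitely many indices, so up to normalization expectations are sums over
    this finite type. *)
Definition sample_path := {ffun seq_sub index_pairs -> 'I_n}.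

(* The value outside [index_pairs] is never used by the algorithm. *)
Definition path_index (phi : sample_path) (s t : nat) : 'I_n :=
  if insub (s, t) is Some v then phi v else Ordinal n_gt0.

Lemma path_index_val (phi : sample_path) v : path_index phi (val v).1 (val v).2 = phi v.
Proof. by rewrite /path_index -surjective_pairing valK. Qed.

Lemma path_index_set v (phi : sample_path) i s t :
  (s, t) != val v -> path_index (set_coord v phi i) s t = path_index phi s t.
Proof.
move=> stv; rewrite /path_index; case: insubP => //= u _ uE.
rewrite ffunE; case: (eqVneq u v) => // uv; case/eqP: stv; rewrite -uv.
exact: esym uE.
Qed.

(** Conditional expectation given all indices other than the one at [(s, t)], on which [h] does not
    depend through its first argument. *)
Lemma sum_path_index_avg (R : realType) s t (h : sample_path -> 'I_n -> R) :
  (1 <= s <= S)%N -> (t < epoch_len m0 s)%N ->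
  (forall phi phi' j, (forall r q, (r, q) != (s, t) ->
     path_index phi r q = path_index phi' r q) -> h phi j = h phi' j) ->
  \sum_phi h phi (path_index phi s t) = \sum_phi n%:R^-1 * \sum_i h phi i.
Proof.
move=> sS tm hext.
have st : (s, t) \in index_pairs by rewrite mem_index_pairs sS tm.
pose v : seq_sub index_pairs := SeqSub st.
rewrite -(@sum_coord_avg _ _ _ v n_gt0).
  by apply: eq_bigr => phi _; rewrite -(path_index_val phi v).
by move=> phi i j; apply: hext => r q rq; rewrite path_index_set.
Qed.

End sample_paths.

Lemma telescope_le (R : realType) (X Y : nat -> R) (Z : R) (m : nat) :
  (forall t, (t < m)%N -> X t.+1 + Y t <= X t + Z) ->
  X m + \sum_(t < m) Y t <= X 0 + m%:R * Z.
Proof.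
elim: m => [|m IH] H; first by rewrite big_ord0 mul0r.
have := H m (ltnSn m); have := IH (fun t tm => H t (ltnW tm)).
rewrite big_ord_recr -natr1 mulrDl mul1r /=; lra.
Qed.

(* Otherwise unification unfolds the whole run of the algorithm. *)
Opaque iterate snapshot.

Section descent.
Variables (R : realType) (n d : nat) (f_ : 'I_n -> 'rV[R]_d -> R)
  (Psi : 'rV[R]_d -> \bar R) (L l : R) (xstar : 'rV[R]_d).
Hypotheses (n_gt0 : (1 <= n)%N) (df : forall i x, differentiable (f_ i) x)
  (Psi_proper : proper_fun Psi) (Psi_convex : convex_fun Psi)
  (Psi_lsc : lower_semicontinuous Psi)
  (L_gt0 : 0 < L) (l_ge0 : 0 <= l)
  (f_convex : convex_function setT (avg_fun f_))
  (f_upper : forall i, upper_smooth L (f_ i))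
  (f_lower : forall i, lower_smooth l (f_ i))
  (xstar_min : minimizer (composite f_ Psi) xstar).
Variables (xphi : 'rV[R]_d) (m0 S : nat) (eta c : R).
Local Notation f := (avg_fun f_).
Local Notation dom x := (Psi x \is a fin_num).
Local Notation step := (step_len m0 S eta).
Local Notation len := (epoch_len m0).
Local Notation gap := (gap f_ Psi xstar).
Local Notation sqdist := (sqdist xstar).
Local Notation iterate := (iterate f_ Psi xphi m0 S eta).
Local Notation snapshot := (snapshot f_ Psi xphi m0 S eta).
Hypotheses (xphi_dom : dom xphi) (m0_gt0 : (0 < m0)%N) (c_ge0 : 0 <= c)
  (eta_ge0 : 0 <= eta).
Hypotheses
  (step_gt0 : forall s t, (s < S)%N -> (t < len s.+1)%N -> 0 < step s.+1 t.+1)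
  (step_L : forall s t, (s < S)%N -> (t < len s.+1)%N -> step s.+1 t.+1 * L <= 1 / 13)
  (step_Ll : forall s t, (s < S)%N -> (t < len s.+1)%N ->
     13 / 12 * step s.+1 t.+1 * L * l <= c)
  (step_decr : forall s t, (s < S)%N -> (t < len s.+1)%N ->
     (2 * step s.+1 t.+1)^-1 + 3 * c <= (2 * step s.+1 t)^-1)
  (step_glue : forall s, (s < S)%N -> step s.+2 0 = step s.+1 (len s.+1)).
Implicit Types (idx : nat -> nat -> 'I_n) (s t : nat).

Lemma len_gt0 s : (0 < len s)%N.
Proof. by rewrite muln_gt0 expn_gt0 m0_gt0. Qed.

Lemma gap_convex u v (a : R) : 0 <= a <= 1 -> dom u -> dom v ->
  dom (a *: u + (1 - a) *: v) /\
  gap (a *: u + (1 - a) *: v) <= a * gap u + (1 - a) * gap v.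
Proof.
move=> a01 uf vf.
have [zf zle] := convex_fin_num Psi_proper Psi_convex a01 uf vf.
split=> //; have := convex_functionP f_convex u v a01.
by rewrite /gap; lra.
Qed.

Lemma sqdist_convex u v (a : R) : 0 <= a <= 1 -> dom u -> dom v ->
  dom (a *: u + (1 - a) *: v) /\
  sqdist (a *: u + (1 - a) *: v) <= a * sqdist u + (1 - a) * sqdist v.
Proof.
move=> a01 uf vf.
have [zf _] := convex_fin_num Psi_proper Psi_convex a01 uf vf.
split=> //; have := dot_sqr_conv (u - xstar) (v - xstar) a01.
rewrite /sqdist; have -> // : a *: u + (1 - a) *: v - xstar =
  a *: (u - xstar) + (1 - a) *: (v - xstar).
by apply/rowP => j; rewrite !mxE; ring.
Qed.

Lemma iterate_dom idx s t : (s < S)%N -> (t <= len s.+1)%N ->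
  dom (iterate idx s 0) -> dom (iterate idx s t).
Proof.
case: t => [//|t] sS tm _; rewrite iterateS.
apply: (svrg_step_dom n_gt0 df Psi_proper Psi_convex Psi_lsc f_upper xstar_min).
exact: step_gt0.
Qed.

Lemma snapshot_iterate0_dom idx s : (s <= S)%N ->
  dom (snapshot idx s) /\ dom (iterate idx s 0).
Proof.
elim: s => [|s IH] sS; first by rewrite snapshot0 iterate0.
have [_ d0] := IH (ltnW sS).
have dt t : (t <= len s.+1)%N -> dom (iterate idx s t) by move=> ts; exact: iterate_dom.
rewrite iterate_epochS; split; last exact: dt.
rewrite snapshotS.
exact: (jensen_mean gap_convex (len_gt0 s.+1) (fun t ts => dt t (ltnW ts))).1.
Qed.

Lemma snapshot_mean_le idx s : (s < S)%N ->
  (len s.+1)%:R * gap (snapshot idx s.+1) <= \sum_(t < len s.+1) gap (iterate idx s t) /\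
  (len s.+1)%:R * sqdist (snapshot idx s.+1) <= \sum_(t < len s.+1) sqdist (iterate idx s t).
Proof.
move=> sS; have [_ d0] := snapshot_iterate0_dom idx (ltnW sS).
have dt t : (t < len s.+1)%N -> dom (iterate idx s t).
  by move=> /ltnW ts; exact: iterate_dom.
rewrite snapshotS; split.
  exact: (jensen_mean gap_convex (len_gt0 s.+1) dt).2.
exact: (jensen_mean sqdist_convex (len_gt0 s.+1) dt).2.
Qed.

Local Notation path := (sample_path m0 S n).
Local Notation it phi := (iterate (@path_index m0 S n n_gt0 phi)).
Local Notation snap phi := (snapshot (@path_index m0 S n n_gt0 phi)).
Local Notation pot s t x := (gap x + sqdist x / (2 * step s t)).


(** The index at [(s.+1, t)] is averaged out with [svrg_step_expected]. The drop of [3 * c] in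
    [step_decr] pays the term [c * sqdist] of the current iterate and leaves the gain
    [2 * c * sqdist]; likewise [5 / 6] of its gap is left. *)
Lemma sum_step_le s t : (s < S)%N -> (t < len s.+1)%N ->
  \sum_(phi : path) pot s.+1 t.+1 (it phi s t.+1)
  + \sum_(phi : path) (5 / 6 * gap (it phi s t) + 2 * c * sqdist (it phi s t)) <=
  \sum_(phi : path) pot s.+1 t (it phi s t)
  + \sum_(phi : path) (gap (snap phi s) / 6 + c * sqdist (snap phi s)).
Proof.
move=> sS tm; have h0 := step_gt0 sS tm.
pose H (phi : path) i :=
  pot s.+1 t.+1 (svrg_step f_ Psi (step s.+1 t.+1) (it phi s t) (snap phi s) i).
have HE : \sum_(phi : path) pot s.+1 t.+1 (it phi s t.+1) =
    \sum_(phi : path) n%:R^-1 * \sum_i H phi i.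
  have sS1 : (1 <= s.+1 <= S)%N by [].
  rewrite -(@sum_path_index_avg m0 S n n_gt0 R s.+1 t H sS1 tm).
    by apply: eq_bigr => phi _; rewrite /H -iterateS.
  move=> phi phi' j E; rewrite /H.
  have [|-> ->] := @iterate_ext R n d f_ Psi xphi m0 S eta (@path_index m0 S n n_gt0 phi)
    (@path_index m0 S n n_gt0 phi') s t _ (ltnW tm); last by [].
  move=> r q _ _ rq; apply: E; apply/eqP => -[rE qE]; move: rq; rewrite rE qE; lia.
rewrite HE -!big_split /=; apply: ler_sum => phi _; rewrite -lerBrDr.
have [sd d0] := snapshot_iterate0_dom (@path_index m0 S n n_gt0 phi) (ltnW sS).
have xd := iterate_dom sS (ltnW tm) d0.
apply: le_trans (svrg_step_expected n_gt0 df Psi_proper Psi_convex Psi_lsc L_gt0 l_ge0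
  f_convex f_upper f_lower xstar_min h0 (step_L sS tm) xd sd) _.
have := ler_wpM2r (addr_ge0 (sqdist_ge0 xstar (it phi s t)) (sqdist_ge0 xstar (snap phi s)))
  (step_Ll sS tm).
have := ler_wpM2r (sqdist_ge0 xstar (it phi s t)) (step_decr sS tm).
move: (gap _) (gap _) (sqdist _) (sqdist _) (step _ _) (step _ _) => a a' x x' h h'.
lra.
Qed.

Lemma sum_epoch_le s m : (s < S)%N -> (m <= len s.+1)%N ->
  \sum_(phi : path) pot s.+1 m (it phi s m)
  + \sum_(t < m) \sum_(phi : path) (5 / 6 * gap (it phi s t) + 2 * c * sqdist (it phi s t)) <=
  \sum_(phi : path) pot s.+1 0 (it phi s 0)
  + m%:R * \sum_(phi : path) (gap (snap phi s) / 6 + c * sqdist (snap phi s)).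
Proof.
move=> sS mm.
apply: (@telescope_le R (fun t => \sum_(phi : path) pot s.+1 t (it phi s t))
  (fun t => \sum_(phi : path) (5 / 6 * gap (it phi s t) + 2 * c * sqdist (it phi s t)))).
by move=> t tm; apply: sum_step_le => //; exact: leq_trans mm.
Qed.

(** The weight is half the length of epoch [s.+1], so the snapshot terms equal the total charge
    [gap / 6 + c * sqdist] per step of that epoch. *)
Definition potential s : R := \sum_(phi : path) (pot s.+1 0 (it phi s 0)
  + (2 ^ s * m0)%:R * (gap (snap phi s) / 3 + 2 * c * sqdist (snap phi s))).

(** By Jensen the gains over the epoch dominate its length times the corresponding terms at the new
    snapshot. Of the factor [5 / 6] of the gap only [1 / 3] is kept. *)
Lemma potential_decr s : (s < S)%N -> potential s.+1 <= potential s.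
Proof.
move=> sS; have := sum_epoch_le sS (leqnn _).
rewrite exchange_big mulr_sumr -!big_split /= => H.
apply: le_trans (le_trans _ H) _; apply: ler_sum => phi _; last first.
  by rewrite /epoch_len expnS -mulnA natrM; lra.
rewrite step_glue// iterate_epochS lerD2l.
have [sg sd] := snapshot_mean_le (@path_index m0 S n n_gt0 phi) sS.
rewrite big_split /= -!mulr_sumr.
have g0 : 0 <= \sum_(t < len s.+1) gap (it phi s t).
  apply: sumr_ge0 => t _; apply: (gap_ge0 Psi_proper xstar_min).
  have [_ d0] := snapshot_iterate0_dom (@path_index m0 S n n_gt0 phi) (ltnW sS).
  by apply: iterate_dom => //; exact: ltnW.
have := ler_wpM2l c_ge0 sd.
rewrite -/(len s.+1).
move: (\sum_(t < _) _) (\sum_(t < _) _) sg sd g0 => ? ? ? ? ?; lra.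
Qed.

Lemma sum_gap_snapshot_le :
  (2 ^ S * m0)%:R / 3 * \sum_(phi : path) gap (snap phi S) <=
  #|{: path}|%:R * (gap xphi + sqdist xphi / (2 * step 1 0)
     + m0%:R * (gap xphi / 3 + 2 * c * sqdist xphi)).
Proof.
have : potential S <= potential 0.
  have : forall s, (s <= S)%N -> potential s <= potential 0.
    elim=> [//|s IH] sS; exact: le_trans (potential_decr sS) (IH (ltnW sS)).
  exact.
have -> : potential 0 = #|{: path}|%:R * (gap xphi + sqdist xphi / (2 * step 1 0)
     + m0%:R * (gap xphi / 3 + 2 * c * sqdist xphi)).
  rewrite /potential; under eq_bigr do rewrite iterate0 snapshot0.
  by rewrite sumr_const expn0 mul1n [RHS]mulr_natl.
apply: le_trans; rewrite mulr_sumr; apply: ler_sum => phi _.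
(* [it phi S 0] is the last iterate; its nonnegative terms and the squared distance of the snapshot
   are dropped. *)
have [sd d0] := snapshot_iterate0_dom (@path_index m0 S n n_gt0 phi) (leqnn S).
have g0 := gap_ge0 Psi_proper xstar_min d0.
have q0 := sqdist_ge0 xstar (it phi S 0).
have s0 : 0 <= step S.+1 0 by rewrite /step_len divr_ge0 ?mulr_ge0 ?sqrtr_ge0.
have b0 : 0 <= sqdist (it phi S 0) / (2 * step S.+1 0) by rewrite divr_ge0// mulr_ge0.
have k0 : 0 <= (2 ^ S * m0)%:R * (2 * c * sqdist (snap phi S)).
  by rewrite !mulr_ge0// sqdist_ge0.
move: k0 b0 g0; move: ((2 ^ S * m0)%:R : R) (gap (it phi S 0)) (_ / (2 * _)) => N g b.
move: (gap _) (sqdist (snap phi S)) => g' q; lra.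
Qed.

End descent.

(** * Expectation over the random indices *)

Section expectation.
Variables (R : realType) (disp : measure_display) (Omega : measurableType disp)
  (P : probability Omega R) (n m0 S : nat) (I : nat -> nat -> Omega -> 'I_n).
Hypotheses (n_gt0 : (1 <= n)%N) (I_unif : uniform_indep_indices P m0 S I).
Local Notation path := (sample_path m0 S n).
Implicit Type phi : path.

(** Shaped like the event in the product rule of [uniform_indep_indices], with singletons for
    [A]. *)
Definition path_event phi : set Omega :=
  [set w | forall s t : nat, (1 <= s <= S)%N -> (t < epoch_len m0 s)%N ->
     [set path_index n_gt0 phi s t] (I s t w)].

Lemma measurable_path_event phi : measurable (path_event phi).
Proof.
have -> : path_event phi = \bigcap_s \bigcap_t [set w | (1 <= s <= S)%N ->
    (t < epoch_len m0 s)%N -> [set path_index n_gt0 phi s t] (I s t w)].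
  by apply/seteqP; split=> w H s; [move=> _ t _; exact: H|move=> t; exact: H].
have [mI _ _] := I_unif.
apply: bigcapT_measurable => s; apply: bigcapT_measurable => t.
have [sS|sS] := boolP (1 <= s <= S)%N; last first.
  by rewrite [X in measurable X](_ : _ = setT)//; apply/seteqP; split.
have [tm|tm] := boolP (t < epoch_len m0 s)%N; last first.
  by rewrite [X in measurable X](_ : _ = setT)//; apply/seteqP; split.
rewrite [X in measurable X](_ : _ = I s t @^-1` [set path_index n_gt0 phi s t]).
  exact: mI.
by apply/seteqP; split=> w; [apply|move=> ? _ _].
Qed.

Lemma path_event_prob phi phi' : P (path_event phi) = P (path_event phi').
Proof.
have [_ uI indI] := I_unif.
rewrite !(indI (fun s t => [set path_index n_gt0 _ s t])).
apply: eq_big_nat => s sS; apply: eq_big_nat => t /andP[_ tm].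
by rewrite !uI// -ltnS.
Qed.

Lemma path_event_ex w : exists phi0, forall phi, path_event phi w <-> phi = phi0.
Proof.
exists [ffun v : seq_sub (index_pairs m0 S) => I (val v).1 (val v).2 w] => phi.
split=> [H|-> s t sS tm].
  apply/ffunP => v; rewrite ffunE -(path_index_val n_gt0 phi).
  have := valP v; rewrite /= [X in X \in _]surjective_pairing mem_index_pairs.
  by case/andP => v1 v2; rewrite H.
have st : (s, t) \in index_pairs m0 S by rewrite mem_index_pairs sS tm.
by rewrite -[s]/((s, t).1) -[t in path_index _ _ _ t]/((s, t).2)
  -[(s, t)]/(val (SeqSub st)) path_index_val ffunE.
Qed.

(** The path events partition [Omega] and are equally likely, and [X] is constant on each, so it is
    a finite combination of indicators. *)
Lemma expectation_uniform (X : Omega -> \bar R) (G : path -> R) :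
  (forall phi, 0 <= G phi) ->
  (forall w phi, path_event phi w -> X w = (G phi)%:E) ->
  (\int[P]_w X w = (#|{: path}|%:R^-1 * \sum_phi G phi)%:E)%E.
Proof.
move=> G0 XG.
have key (H : path -> R) (Y : Omega -> \bar R) : (forall phi, 0 <= H phi) ->
    (forall w phi, path_event phi w -> Y w = (H phi)%:E) ->
    (\int[P]_w Y w = \sum_(phi : path) (H phi)%:E * P (path_event phi))%E.
  move=> H0 YH.
  transitivity (\int[P]_w (\sum_(phi : path) (H phi)%:E * (\1_(path_event phi) w)%:E))%E.
    apply: eq_integral => w _; have [phi0 w0] := path_event_ex w.
    have we : path_event phi0 w by apply/w0.
    rewrite (YH _ _ we) (bigD1 phi0)//= indicE mem_set// mule1 big1 ?adde0// => phi ne.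
    by rewrite indicE memNset ?mule0// => /w0 E; rewrite E eqxx in ne.
  rewrite ge0_integral_sum//.
  - apply: eq_bigr => phi _; rewrite ge0_integralZl//.
    + by rewrite integral_indic ?setIT//; exact: measurable_path_event.
    + by apply/measurable_EFinP; apply: measurable_indic; exact: measurable_path_event.
    + by rewrite lee_fin H0.
  - move=> phi; apply: measurable_funeM; apply/measurable_EFinP.
    by apply: measurable_indic; exact: measurable_path_event.
  - by move=> phi w _; rewrite mule_ge0// lee_fin ?H0.
pose phi1 : path := [ffun=> Ordinal n_gt0].
have pE phi : P (path_event phi) = (fine (P (path_event phi1)))%:E.
  rewrite (path_event_prob phi phi1) fineK//; apply: fin_num_measure.
  exact: measurable_path_event.
have sumE (H : path -> R) : (\sum_(phi : path) (H phi)%:E * P (path_event phi) =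
    (fine (P (path_event phi1)) * \sum_phi H phi)%:E)%E.
  rewrite mulr_sumr -sumEFin; apply: eq_bigr => phi _.
  by rewrite pE -EFinM mulrC.
(* Integrating the constant 1 shows that the common probability is the inverse of the number of
   paths. *)
have := key (fun=> 1) (cst 1%E) (fun=> ler01) (fun _ _ _ => erefl).
rewrite sumE integral_cst// mul1e => /(etrans (esym (probability_setT P))) -[].
rewrite sumr_const => p1.
rewrite (key _ _ G0 XG) sumE; congr (_ * _)%:E.
have c0 : #|{: path}|%:R != 0 :> R.
  by rewrite pnatr_eq0 -lt0n; apply/card_gt0P; exists phi1.
by apply: (mulIf c0); rewrite mulVf.
Qed.

End expectation.

(** * Growth of the step lengths *)

Section step_lengths.
Variables (R : realType) (m0 S : nat).
Local Notation len := (epoch_len m0).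
Local Notation T := (total_len m0 S).

(** A geometric sum, arranged to avoid truncated subtraction. *)
Lemma sum_epoch_len s : (\sum_(1 <= r < s.+1) len r + 2 * m0 = 2 ^ s.+1 * m0)%N.
Proof.
elim: s => [|s IH]; first by rewrite big_geq.
have E1 : epoch_len m0 s.+1 = (2 ^ s.+1 * m0)%N by [].
have E2 : (2 ^ s.+2 * m0 = 2 * (2 ^ s.+1 * m0))%N by rewrite expnS mulnA.
by rewrite big_nat_recr//= E1 E2 -IH; lia.
Qed.

Lemma total_len_ge s t : (s < S)%N -> (t < len s.+1)%N ->
  (\sum_(1 <= r < s.+1) len r + t < T)%N.
Proof.
move=> sS ts; have := sum_epoch_len s.+1; have := sum_epoch_len S.
rewrite -/T big_nat_recr//=.
have : (2 ^ s.+2 * m0 <= 2 ^ S.+1 * m0)%N by rewrite leq_mul2r leq_exp2l// ltnS sS orbT.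
lia.
Qed.

(** The difference of the roots times their sum is 1, and each root is at most
    [Num.sqrt (2 * b)]. *)
Lemma sqrt_diff_ge (a b : R) : 1 <= a -> a <= 2 * b ->
  1 <= (Num.sqrt a - Num.sqrt (a - 1)) * (2 * (Num.sqrt 2 * Num.sqrt b)).
Proof.
move=> a1 ab.
have b0 : 0 <= b by lra.
have sab : Num.sqrt a <= Num.sqrt 2 * Num.sqrt b by rewrite -sqrtrM// ler_wsqrtr.
have xx : Num.sqrt a ^+ 2 = a by rewrite sqr_sqrtr//; lra.
have yy : Num.sqrt (a - 1) ^+ 2 = a - 1 by rewrite sqr_sqrtr//; lra.
have yx : Num.sqrt (a - 1) <= Num.sqrt a by rewrite ler_wsqrtr//; lra.
have y0 := sqrtr_ge0 (a - 1).
move: (Num.sqrt a) (Num.sqrt (a - 1)) (Num.sqrt 2 * Num.sqrt b) sab xx yy yx y0.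
move=> x y z sab xx yy yx y0.
have E : (x - y) * (x + y) = 1 by rewrite -subr_sqr xx yy; ring.
rewrite -[X in X <= _]E; apply: ler_wpM2l; lra.
Qed.

Variable eta : R.
Hypotheses (eta_gt0 : 0 < eta).
Local Notation step := (step_len m0 S eta).

Lemma step_lenVE s t : (0 < T)%N ->
  (2 * step s t)^-1 =
  Num.sqrt (2 * T%:R - (\sum_(1 <= r < s) len r + t)%N%:R) / (2 * eta * Num.sqrt T%:R).
Proof. by move=> T0; rewrite /step_len !invfM !invrK; ring. Qed.

Lemma step_len_gt0 s t : (s < S)%N -> (t < len s.+1)%N -> 0 < step s.+1 t.+1.
Proof.
move=> sS ts; have := total_len_ge sS ts; rewrite -addnS => kT.
have T0 : (0 < T)%N by exact: leq_ltn_trans (total_len_ge sS ts).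
have kR : (\sum_(1 <= r < s.+1) len r + t.+1)%N%:R <= T%:R :> R by rewrite ler_nat.
have TR : 0 < T%:R :> R by rewrite ltr0n.
rewrite /step_len divr_gt0 ?mulr_gt0 ?sqrtr_gt0//; lra.
Qed.

Lemma step_len_le s t : (s < S)%N -> (t < len s.+1)%N -> step s.+1 t.+1 <= eta.
Proof.
move=> sS ts; have := total_len_ge sS ts; rewrite -addnS => kT.
have T0 : (0 < T)%N by exact: leq_ltn_trans (total_len_ge sS ts).
have kR : (\sum_(1 <= r < s.+1) len r + t.+1)%N%:R <= T%:R :> R by rewrite ler_nat.
have TR : 0 < T%:R :> R by rewrite ltr0n.
rewrite /step_len ler_pdivrMr ?sqrtr_gt0; last lra.
by rewrite ler_pM2l// ler_wsqrtr//; lra.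
Qed.

Lemma step_len_glue s : step s.+2 0 = step s.+1 (len s.+1).
Proof. by rewrite /step_len addn0 big_nat_recr. Qed.

(** The inverse step is proportional to [Num.sqrt (2 * T - k)], so one step lowers it by at least
    [1 / (4 * Num.sqrt 2 * eta * T)]. *)
Lemma step_lenV_decr (c : R) s t : (s < S)%N -> (t < len s.+1)%N ->
  12 * Num.sqrt 2 * c * eta * T%:R <= 1 ->
  (2 * step s.+1 t.+1)^-1 + 3 * c <= (2 * step s.+1 t)^-1.
Proof.
move=> sS ts cT; have := total_len_ge sS ts => kT.
have T0 : (0 < T)%N by exact: leq_ltn_trans (total_len_ge sS ts).
rewrite !step_lenVE// addnS.
have kR : (\sum_(1 <= r < s.+1) len r + t)%N.+1%:R <= T%:R :> R by rewrite ler_nat.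
move: kR; rewrite -natr1; move: (_ + t)%N => k kR.
have TR : 0 < T%:R :> R by rewrite ltr0n.
have k0 : 0 <= k%:R :> R by [].
have := @sqrt_diff_ge (2 * T%:R - k%:R) T%:R.
have -> : 2 * T%:R - k%:R - 1 = 2 * T%:R - (k%:R + 1) :> R by ring.
have TT : Num.sqrt T%:R * Num.sqrt T%:R = T%:R :> R by rewrite -expr2 sqr_sqrtr// ltW.
have sT : 0 < Num.sqrt T%:R :> R by rewrite sqrtr_gt0.
have s2 : 0 < Num.sqrt 2 :> R by rewrite sqrtr_gt0.
move: TT sT cT s2; move: (Num.sqrt T%:R) (Num.sqrt 2) => q r2 TT q0 cT r20.
move=> H; have {}H := H ltac:(lra) ltac:(lra).
move: H; move: (Num.sqrt _) (Num.sqrt _) => x y H.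
rewrite -lerBrDl -mulrBl ler_pdivlMr; last by rewrite !mulr_gt0.
rewrite -TT in cT.
have r2q : 0 < 2 * (r2 * q) by rewrite !mulr_gt0.
rewrite -(ler_pM2r r2q); apply: le_trans H; apply: le_trans cT.
by rewrite le_eqVlt; apply/orP; left; apply/eqP; ring.
Qed.

End step_lengths.

(** * Numerical constants and the final bounds *)

Lemma svrg_eta_bounds (R : realType) (L l Theta eps : R) :
  0 < L -> 0 <= l -> 0 < Theta -> 0 < eps ->
  let eta := svrg_eta L l Theta eps in
  [/\ 0 < eta, eta * L <= 1 / 13, eta * (312 * Num.sqrt 2 * Theta * L * l) <= eps
    & eta^-1 <= 13 * L + 312 * Num.sqrt 2 * Theta * L * l / eps].
Proof.
move=> L0 l0 T0 e0 /=; rewrite /svrg_eta.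
have s2 : 0 < Num.sqrt 2 :> R by rewrite sqrtr_gt0.
have iL : 1 / (13 * L) * L = 1 / 13 by field; rewrite gt_eqF.
have pL : 0 < 1 / (13 * L) by rewrite divr_gt0// mulr_gt0.
have VL : (1 / (13 * L))^-1 = 13 * L by rewrite div1r invrK.
have [->|lne] := eqVneq l 0.
  by rewrite VL mulr0 mul0r addr0; split; rewrite ?iL// mulr0 ltW.
have lp : 0 < l by rewrite lt_neqAle eq_sym lne.
set K := 312 * _ * _ * _ * _.
have K0 : 0 < K by rewrite /K !mulr_gt0.
have pK : 0 < eps / K by rewrite divr_gt0.
split.
- by rewrite lt_min pL pK.
- by rewrite -iL ler_wpM2r ?(ltW L0)// ge_min lexx.
- by rewrite -ler_pdivlMr// ge_min lexx orbT.
- rewrite minElt; case: ifP => _; first by rewrite VL lerDl divr_ge0 ?ltW.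
  by rewrite invf_div lerDr mulr_ge0// ltW.
Qed.

Lemma ln2_ge_half (R : realType) : 1 / 2 <= ln 2 :> R.
Proof.
have := @le_ln1Dx R (- (1 / 2)); have -> : 1 + - (1 / 2) = 2^-1 :> R by field.
rewrite lnV ?posrE// => H.
by have := H ltac:(lra); lra.
Qed.

Lemma sqrt2_le (R : realType) : Num.sqrt 2 <= 3 / 2 :> R.
Proof.
have h32 : 0 <= 3 / 2 :> R by lra.
by rewrite -(@ler_sqr R) ?nnegrE ?sqrtr_ge0// sqr_sqrtr//; lra.
Qed.

Lemma total_len_le (m0 S : nat) : (total_len m0 S <= 2 * (2 ^ S * m0))%N.
Proof. by have := sum_epoch_len m0 S; rewrite expnS -mulnA /total_len; lia. Qed.

Lemma svrg_cost_le (R : realType) (n m0 S : nat) :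
  (S * n + 2 * total_len m0 S)%N%:R <= 4 * (S%:R * n%:R + 2 ^+ S * m0%:R) :> R.
Proof.
have T2 := total_len_le m0 S.
rewrite -natrX -!natrM -natrD -natrM ler_nat; lia.
Qed.

(** The inverse of the minimum defining [eta] is at most the sum of the inverses, which yields the
    last two terms; [ln 2 >= 1 / 2] turns [S] into a natural logarithm. *)
Lemma total_complexity_le (R : realType) (L l Theta Delta eps : R) (n m0 S : nat) :
  0 < L -> 0 <= l -> 0 < Theta -> 0 < Delta -> 0 < eps ->
  2 ^+ S * m0%:R = Theta / (svrg_eta L l Theta eps * eps) ->
  S%:R = log2 (Delta / eps) ->
  S%:R * n%:R + 2 ^+ S * m0%:R
    <= 500 * (n%:R * ln (Delta / eps) + L * Theta / eps
              + L * l * Theta ^+ 2 / eps ^+ 2).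
Proof.
move=> L0 l0 T0 D0 e0 -> SE.
have [h0 _ _ hV] := svrg_eta_bounds L0 l0 T0 e0.
have l2 := ln2_ge_half R.
have l20 : 0 < ln 2 :> R by lra.
have lnE : ln (Delta / eps) = S%:R * ln 2 by rewrite SE /log2 divfK// gt_eqF.
have S0 : 0 <= S%:R * n%:R :> R by rewrite mulr_ge0.
have A1 : S%:R * n%:R <= 500 * (n%:R * ln (Delta / eps)).
  have := ler_wpM2l S0 l2; rewrite lnE; move: S0.
  move: (ln 2) (S%:R : R) (n%:R : R) => x y z; lra.
(* The largest constant is [312 * (3 / 2) = 468], below 500. *)
have s2 := sqrt2_le R.
have P0 : 0 <= Theta / eps by rewrite divr_ge0 ?ltW.
have A2 : Theta / (svrg_eta L l Theta eps * eps) <=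
    500 * (L * Theta / eps) + 500 * (L * l * Theta ^+ 2 / eps ^+ 2).
  have -> : Theta / (svrg_eta L l Theta eps * eps) =
     (svrg_eta L l Theta eps)^-1 * (Theta / eps) by rewrite invfM; ring.
  apply: le_trans (ler_wpM2r P0 hV) _.
  have -> : (13 * L + 312 * Num.sqrt 2 * Theta * L * l / eps) * (Theta / eps) =
    13 * (L * Theta / eps) + 312 * (Num.sqrt 2 * (L * l * Theta ^+ 2 / eps ^+ 2)).
    by field; rewrite gt_eqF.
  have q1 : 0 <= L * Theta / eps by rewrite divr_ge0 ?mulr_ge0 ?ltW.
  have q2 : 0 <= L * l * Theta ^+ 2 / eps ^+ 2.
    have [LL TT ee] := And3 (ltW L0) (ltW T0) (ltW e0).
    by rewrite divr_ge0// ?mulr_ge0// exprn_ge0.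
  have := ler_wpM2r q2 s2; lra.
by rewrite !mulrDr -addrA; exact: lerD.
Qed.

(** Here [m] stands for [m0] and [M] for [2 ^ S * m0]. Each of the three summands on the left is at
    most [Theta / eta = M * eps]. *)
Lemma svrg_constants_le (R : realType) (L l Theta Delta eps eta a q M m : R) :
  0 < eta -> 0 <= L * l -> 0 < Theta -> 0 < eps -> eps <= Delta ->
  eta * (312 * Num.sqrt 2 * Theta * L * l) <= eps ->
  0 <= a -> a <= Delta -> 0 <= q -> q <= Theta -> 1 <= m ->
  m * Delta = Theta / eta -> M * eps = Theta / eta ->
  3 * (a + q / eta + m * (a / 3 + 2 * (13 / 12 * eta * L * l) * q)) <= 15 * eps * M.
Proof.
move=> h0 Ll0 T0 e0 eD hK a0 aD q0 qT m1 mD Me.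
have s2 : 1 <= Num.sqrt 2 :> R by rewrite -[X in X <= _]sqrtr1 ler_wsqrtr//; lra.
have m0 : 0 <= m by lra.
have D0 : 0 <= Delta by lra.
have X0 : 0 <= eta * (Theta * (L * l)).
  by rewrite mulr_ge0 ?(ltW h0)// mulr_ge0 ?(ltW T0).
have X1 : 312 * (eta * (Theta * (L * l))) <= eps.
  apply: le_trans hK.
  have := ler_wpM2r X0 s2; lra.
have Y : eta * L * l * q <= Delta / 312.
  have -> : eta * L * l * q = (eta * (L * l)) * q by ring.
  have : (eta * (L * l)) * q <= (eta * (L * l)) * Theta.
    by rewrite ler_wpM2l// mulr_ge0// ltW.
  lra.
have Q1 : q / eta <= Theta / eta by rewrite ler_pM2r// invr_gt0.
have Q2 : Delta <= Theta / eta.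
  by rewrite -mD ler_peMl.
have Q3 : m * (a / 3 + 2 * (13 / 12 * eta * L * l) * q) <= m * Delta.
  by rewrite ler_wpM2l//; lra.
lra.
Qed.

Lemma mean_le_of_total (R : realType) (M N eps a b b' w s : R) :
  0 < M -> 0 < eps -> 0 <= N -> b <= b' -> 3 * (a + b' + w) <= 15 * eps * M ->
  M / 3 * s <= N * (a + b + w) -> s <= N * (500 * eps).
Proof.
move=> M0 e0 N0 bb H1 H2; rewrite -(ler_pM2l M0).
have H3 : N * (3 * (a + b + w)) <= N * (15 * eps * M).
  by rewrite ler_wpM2l//; lra.
have H4 : 0 <= N * eps * M by rewrite !mulr_ge0// ltW.
lra.
Qed.

Theorem theorem7p1 (R : realType) :
  exists C : R, 0 < C /\
  forall (n d : nat) (f_ : 'I_n -> 'rV[R]_d -> R) (Psi : 'rV[R]_d -> \bar R)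
    (L l : R) (xstar xphi : 'rV[R]_d) (Theta Delta eps : R) (m0 S : nat)
    (disp : measure_display) (Omega : measurableType disp)
    (P : probability Omega R) (I : nat -> nat -> Omega -> 'I_n),
  (1 <= n)%N -> (1 <= d)%N ->
  (forall i x, differentiable (f_ i) x) ->
  proper_fun Psi -> convex_fun Psi -> lower_semicontinuous Psi ->
  0 < L -> 0 <= l ->
  convex_function setT (avg_fun f_) ->
  (forall i, upper_smooth L (f_ i)) ->
  (forall i, lower_smooth l (f_ i)) ->
  let F := composite f_ Psi in
  minimizer F xstar ->
  0 < Theta -> 0 < Delta ->
  enorm (xphi - xstar) ^+ 2 <= Theta ->
  (F xphi - F xstar <= Delta%:E)%E ->
  0 < eps ->
  let eta := svrg_eta L l Theta eps in
  (0 < m0)%N -> m0%:R = Theta / (eta * Delta) ->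
  (0 < S)%N -> S%:R = log2 (Delta / eps) ->
  uniform_indep_indices P m0 S I ->
  let run w := svrg_nc f_ Psi xphi m0 S eta (fun s t => I s t w) in
  [/\ (\int[P]_w (F (run w).1 - F xstar) <= (C * eps)%:E)%E,
      forall w, ((run w).2)%:R <= C * (S%:R * n%:R + 2 ^+ S * m0%:R)
    & S%:R * n%:R + 2 ^+ S * m0%:R
        <= C * (n%:R * ln (Delta / eps) + L * Theta / eps
                + L * l * Theta ^+ 2 / eps ^+ 2)].
Proof.
exists 500; split; first by rewrite ltr0n.
move=> n d f_ Psi L l xstar xphi Theta Delta eps m0 S disp Omega P I.
move=> n0 _ df Psip Psic Psil L0 l0 fc fu fl F xmin T0 D0 xT FD e0 eta.
move=> m00 m0E S0 SE uI run.
have [h0 hL hK _] := svrg_eta_bounds L0 l0 T0 e0.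
rewrite -/eta in h0 hL hK.
have l20 : 0 < ln 2 :> R by have := ln2_ge_half R; lra.
have De : 0 < Delta / eps by rewrite divr_gt0.
have SD : 2 ^+ S = Delta / eps.
  apply: ln_inj; rewrite ?posrE ?exprn_gt0//.
  by rewrite lnXn// -(mulr_natl (ln 2)) SE /log2 divfK// gt_eqF.
(* [m0] and [S] are balanced so that [Theta / eta], the size of the initial potential, is [eps]
   times the final weight. *)
have MQ : 2 ^+ S * m0%:R * eps = Theta / eta.
  by rewrite SD m0E; field; rewrite !gt_eqF.
have eD : eps <= Delta.
  by rewrite -[eps]mul1r -ler_pdivlMr// -SD exprn_ege1// ler1n.
(* A finite bound on the initial gap excludes [Psi xphi = +oo]. *)
have xfin : Psi xphi \is a fin_num.
  have := minimizer_dom Psip xmin; move: FD; rewrite /F /composite.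
  have := Psip.1 xphi; case: (Psi xphi) => // _.
  by case: (Psi xstar).
have gapD : gap f_ Psi xstar xphi <= Delta.
  by move: FD; rewrite /F (composite_gap Psip xmin xfin) lee_fin.
have MT : (total_len m0 S)%:R <= 2 * (2 ^+ S * m0%:R) :> R.
  by rewrite -natrX -!natrM ler_nat total_len_le.
pose c := 13 / 12 * eta * L * l.
have c0 : 0 <= c by rewrite /c !mulr_ge0// ltW.
have T0' : (0 < total_len m0 S)%N.
  by apply: leq_ltn_trans (total_len_ge (s := 0) (t := 0) S0 (len_gt0 m00 _)).
(* The second term of the minimum in [eta] enters here: since [T <= 2 * Theta / (eta * eps)], the
   left side is at most [1 / 12]. *)
have cT : 12 * Num.sqrt 2 * c * eta * (total_len m0 S)%:R <= 1.
  have k0 : 0 <= 12 * Num.sqrt 2 * c * eta by rewrite !mulr_ge0// ltW.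
  apply: le_trans (ler_wpM2l k0 MT) _.
  have -> : 12 * Num.sqrt 2 * c * eta * (2 * (2 ^+ S * m0%:R)) =
    (eta * (312 * Num.sqrt 2 * Theta * L * l)) / (12 * eps).
    have -> : 2 ^+ S * m0%:R = Theta / eta / eps by rewrite -MQ mulfK// gt_eqF.
    by rewrite /c; field; rewrite !gt_eqF.
  rewrite ler_pdivrMr ?mulr_gt0//; lra.
split.
- pose G (phi : sample_path m0 S n) :=
    gap f_ Psi xstar (snapshot f_ Psi xphi m0 S eta (path_index n0 phi) S).
  have sd phi : Psi (snapshot f_ Psi xphi m0 S eta (path_index n0 phi) S) \is a fin_num.
    exact: (@snapshot_iterate0_dom R n d f_ Psi L xstar n0 df Psip Psic Psil fc fu xmin
       xphi m0 S eta xfin m00 (fun s t => @step_len_gt0 R m0 S eta h0 s t)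
       (path_index n0 phi) S (leqnn S)).1.
  rewrite (expectation_uniform (n_gt0 := n0) uI (G := G)).
  + rewrite lee_fin.
    have step_h s t : (s < S)%N -> (t < epoch_len m0 s.+1)%N ->
        step_len m0 S eta s.+1 t.+1 <= eta by exact: step_len_le.
    have := @sum_gap_snapshot_le R n d f_ Psi L l xstar n0 df Psip Psic Psil L0 l0 fc fu fl xmin
      xphi m0 S eta c xfin m00 c0 (ltW h0) (fun s t => @step_len_gt0 R m0 S eta h0 s t).
    have hL' s t : (s < S)%N -> (t < epoch_len m0 s.+1)%N ->
        step_len m0 S eta s.+1 t.+1 * L <= 1 / 13.
      by move=> sS ts; apply: le_trans hL; rewrite ler_pM2r// step_h.
    have hLl s t : (s < S)%N -> (t < epoch_len m0 s.+1)%N ->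
        13 / 12 * step_len m0 S eta s.+1 t.+1 * L * l <= c.
      by move=> sS ts; rewrite /c ler_wpM2r// ler_pM2r// ler_pM2l ?step_h.
    move=> /(_ hL' hLl (fun s t sS ts => step_lenV_decr h0 sS ts cT)
      (fun s _ => step_len_glue m0 S eta s)).
    have a0 := gap_ge0 Psip xmin xfin; have q0 := sqdist_ge0 xstar xphi.
    have qT : sqdist xstar xphi <= Theta by rewrite /sqdist -enorm_sqr.
    have m1 : 1 <= m0%:R :> R by rewrite ler1n.
    have mD : m0%:R * Delta = Theta / eta by rewrite m0E; field; rewrite !gt_eqF.
    have Ll0 : 0 <= L * l by rewrite mulr_ge0// ltW.
    have := svrg_constants_le h0 Ll0 T0 e0 eD hK a0 gapD q0 qT m1 mD MQ.
    (* The initial step length is [eta / Num.sqrt 2]. *)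
    have b1 : sqdist xstar xphi / (2 * step_len m0 S eta 1 0) <= sqdist xstar xphi / eta.
      rewrite ler_wpM2l// step_lenVE// big_geq// addn0 subr0 sqrtrM//.
      have sT : 0 < Num.sqrt (total_len m0 S)%:R :> R by rewrite sqrtr_gt0 ltr0n.
      rewrite -mulf_div divff ?gt_eqF// mulr1 invfM mulrA.
      have s2 : Num.sqrt 2 / 2 <= 1 :> R.
        by have := sqrt2_le R; lra.
      by rewrite ler_piMl// invr_ge0 ltW.
    have c1 : 0 < #|{: sample_path m0 S n}|%:R :> R.
      by rewrite ltr0n; apply/card_gt0P; exists [ffun=> Ordinal n0].
    rewrite ler_pdivrMl// -/G.
    rewrite natrM natrX => H1 H2.
    have M0 : 0 < 2 ^+ S * m0%:R :> R by rewrite mulr_gt0 ?exprn_gt0// ltr0n.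
    exact: mean_le_of_total M0 e0 (ltW c1) b1 H1 H2.
  + by move=> phi; apply: gap_ge0.
  + move=> w phi wphi; rewrite /run svrg_nc_snapshot.
    have -> : snapshot f_ Psi xphi m0 S eta (fun s t => I s t w) S =
        snapshot f_ Psi xphi m0 S eta (path_index n0 phi) S.
      by apply: snapshot_ext => s t sS ts; exact: wphi.
    exact: composite_gap.
- move=> w; rewrite svrg_nc_cost; apply: le_trans (svrg_cost_le _ _ _ _) _.
  by apply: ler_wpM2r; [rewrite addr_ge0 ?mulr_ge0 ?exprn_ge0|rewrite ler_nat].
- apply: total_complexity_le => //; rewrite -/eta.
  by rewrite invfM mulrA -MQ mulfK// gt_eqF.
Qed.
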